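(* For every positive integer $n$ and all $x>0$, $\tau>0$, $$|K_{i\tau}(x)|\le\frac{\Gamma\left(2^{-n-1}\right)}{2^{1-2^{-n}}}\left[\sqrt x\,\sinh\left(\frac{2^n\pi\tau}{2}\right)\right]^{-2^{-n}} .$$
   Context: $K_{i\tau}(x)=\int_0^\infty e^{-x\cosh t}\cos(\tau t)\,dt$ ($x>0$) is the Macdonald function (modified Bessel function of the second kind) of imaginary index; $\Gamma$ is the Euler gamma function. *)

(* Defs.v *)
From HB Require Import structures.
From mathcomp Require Import all_boot all_order all_algebra.
From mathcomp Require Import all_classical all_reals all_analysis.
Set Implicit Arguments.
Unset Strict Implicit.
Unset Printing Implicit Defensive.
Import Order.TTheory GRing.Theory Num.Theory.
Import numFieldNormedType.Exports.
Local Open Scope classical_set_scope.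
Local Open Scope ring_scope.

Definition cosh (R : realType) (t : R) : R := (expR t + expR (- t)) / 2.

Definition sinh (R : realType) (t : R) : R := (expR t - expR (- t)) / 2.

(* Euler's integral, meaningful for 0 < z; the domain excludes 0 because
   [powR] is 0 at base 0 and nonzero exponent. *)
Definition Gamma (R : realType) (z : R) : R :=
  \int[@lebesgue_measure R]_(t in `]0, +oo[) (t `^ (z - 1) * expR (- t)).

(* [macdonald_im tau x] is $K_{i\tau}(x)$, for 0 < x. It is real-valued, so the
   modulus is the absolute value of R. *)
Definition macdonald_im (R : realType) (tau x : R) : R :=
  \int[@lebesgue_measure R]_(t in `[0, +oo[)
     (expR (- (x * cosh t)) * cos (tau * t)).

(* Main.v *)
Require Import Defs.
From HB Require Import structures.
From mathcomp Require Import all_boot all_order all_algebra.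
From mathcomp Require Import all_classical all_reals all_analysis.
From mathcomp Require Import measurable_realfun ring lra.
Import Order.TTheory GRing.Theory Num.Theory.
Import numFieldNormedType.Exports.
Local Open Scope classical_set_scope.
Local Open Scope ring_scope.
Set Implicit Arguments.
Unset Strict Implicit.
Unset Printing Implicit Defensive.

(* Write K for K_{i tau}. Rotating the double integral for K_tau(x)^2 by
   (s, t) = (u - v, u + v) gives the product formula
     K_tau(x)^2 = \int_R K_{2 tau}(2 x cosh v) dv,
   and the same rotation applied to Gamma(a/2)^2 in logarithmic variables gives
     \int_R (2 cosh v)^(-a) dv = Gamma(a/2)^2 / (2 Gamma(a)).
   Hence a bound |K_tau(x)| <= C x^(-p/2) S(tau)^(-p) reproduces itself, with p
   halved and tau doubled in S, and the constants of the theorem are exactly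
   those produced by this recursion.
   For n = 1, the inner integral of the product formula is moved to the line
   Im u = theta < pi/2, which produces the factor e^(-2 theta tau) and leaves
     \int_u e^(2 i tau u) \int_v e^(-z cosh v) dv du,  z = 2 x cosh (u + i theta).
   The integral over v is O(|Im z|^(-1/2)): the trivial bound is used for v up
   to 2 |Im z|^(-1/2) and an integration by parts beyond. Letting theta tend to
   pi/2, there remains the integral of sinh^(-1/2) over the half-line, which is
   \int_R (2 cosh y)^(-1/2) dy. The constant in this argument is just good
   enough because 2 sinh (pi tau) <= e^(pi tau) and Gamma(1/2)^2 >= 2. *)

(** * Hyperbolic functions *)

Section derivation_rules.
Context {R : realType}.
Implicit Types (t u v : R) (f g : R -> R).

Lemma is_derive_expR_comp f t (f' : R) :
  is_derive t 1 f f' -> is_derive t 1 (fun z => expR (f z)) (f' * expR (f t)).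
Proof. by move=> ?; rewrite mulrC; exact: is_derive1_comp. Qed.

Lemma is_derive_cos_comp f t (f' : R) :
  is_derive t 1 f f' -> is_derive t 1 (fun z => cos (f z)) (f' * - sin (f t)).
Proof. by move=> ?; rewrite mulrC; exact: is_derive1_comp. Qed.

Lemma is_derive_sin_comp f t (f' : R) :
  is_derive t 1 f f' -> is_derive t 1 (fun z => sin (f z)) (f' * cos (f t)).
Proof. by move=> ?; rewrite mulrC; exact: is_derive1_comp. Qed.

Lemma is_derive_mul f g t (f' g' : R) :
  is_derive t 1 f f' -> is_derive t 1 g g' ->
  is_derive t 1 (fun z => f z * g z) (f t * g' + g t * f').
Proof. by move=> ? ?; exact: is_deriveM. Qed.

Lemma is_derive_add f g t (f' g' : R) :
  is_derive t 1 f f' -> is_derive t 1 g g' ->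
  is_derive t 1 (fun z => f z + g z) (f' + g').
Proof. by move=> ? ?; exact: is_deriveD. Qed.

Lemma is_derive_opp f t (f' : R) :
  is_derive t 1 f f' -> is_derive t 1 (fun z => - f z) (- f').
Proof. by move=> ?; exact: is_deriveN. Qed.

Lemma is_derive_const (c t : R) : is_derive t 1 (fun=> c) 0.
Proof. exact: is_derive_cst. Qed.

Lemma is_derive_var t : is_derive t 1 (fun z : R => z) 1.
Proof. exact: is_derive_id. Qed.

Lemma is_derive_inv f t (f' : R) : f t != 0 ->
  is_derive t 1 f f' -> is_derive t 1 (fun z => (f z)^-1) (- f' / f t ^+ 2).
Proof.
move=> ft0 df; have dV : derivable (fun z => (f z)^-1) t 1.
  by apply: derivableV => //; case: df.
apply: DeriveDef => //; rewrite deriveV//.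
by rewrite (@derive_val _ _ _ _ _ _ _ df) /GRing.scale /= mulNr mulNr mulrC.
Qed.

Ltac derive0 :=
  repeat first
    [ assumption | apply: is_derive_const | apply: is_derive_var
    | apply: is_derive_expR_comp | apply: is_derive_mul
    | apply: is_derive_opp | apply: is_derive_add ].

Lemma is_derive_cosh_comp f t (f' : R) :
  is_derive t 1 f f' -> is_derive t 1 (fun z => cosh (f z)) (f' * sinh (f t)).
Proof.
move=> df; rewrite /cosh /sinh.
have dm : is_derive t 1 (fun z => (expR (f z) + expR (- f z)) * 2^-1)
   ((expR (f t) + expR (- f t)) * 0 +
    2^-1 * (f' * expR (f t) + - f' * expR (- f t))).
  by derive0.
by apply: (is_derive_eq dm); lra.
Qed.

Lemma is_derive_sinh_comp f t (f' : R) :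
  is_derive t 1 f f' -> is_derive t 1 (fun z => sinh (f z)) (f' * cosh (f t)).
Proof.
move=> df; rewrite /cosh /sinh.
have dm : is_derive t 1 (fun z => (expR (f z) - expR (- f z)) * 2^-1)
   ((expR (f t) - expR (- f t)) * 0 +
    2^-1 * (f' * expR (f t) - - f' * expR (- f t))).
  by derive0.
by apply: (is_derive_eq dm); lra.
Qed.

Lemma is_derive_continuous f f' :
  (forall t, is_derive t 1 f (f' t)) -> continuous f.
Proof.
move=> df t; apply/differentiable_continuous/derivable1_diffP.
by case: (df t).
Qed.

End derivation_rules.

(** The derivatives of the subterms stay unknown during unification, so these rules compute the
    derivative of an explicit expression. [derive_to] then leaves the comparison with the announced
    value. *)
Ltac derive_step := first
  [ assumption
  | notypeclasses refine (is_derive_const _ _)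
  | notypeclasses refine (is_derive_var _)
  | notypeclasses refine (is_derive_expR_comp _)
  | notypeclasses refine (is_derive_cos_comp _)
  | notypeclasses refine (is_derive_sin_comp _)
  | notypeclasses refine (is_derive_cosh_comp _)
  | notypeclasses refine (is_derive_sinh_comp _)
  | notypeclasses refine (is_derive_mul _ _)
  | notypeclasses refine (is_derive_opp _)
  | notypeclasses refine (is_derive_add _ _) ].
Ltac derive := repeat derive_step.

Ltac derive_to := notypeclasses refine (is_derive_eq _ _); [derive|].

Section hyperbolic_functions.
Context {R : realType}.
Implicit Types (t u v : R) (f g : R -> R).

Lemma continuous_cosh : continuous (@cosh R).
Proof.
by apply: (@is_derive_continuous _ _ (fun t => 1 * sinh t)) => t; derive.
Qed.

Lemma continuous_sinh : continuous (@sinh R).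
Proof.
by apply: (@is_derive_continuous _ _ (fun t => 1 * cosh t)) => t; derive.
Qed.

Lemma coshN t : cosh (- t) = cosh t.
Proof. by rewrite /cosh opprK addrC. Qed.

Lemma sinhN t : sinh (- t) = - sinh t.
Proof. by rewrite /sinh opprK; lra. Qed.

Lemma sinh0 : sinh (0 : R) = 0.
Proof. by rewrite /sinh oppr0 subrr mul0r. Qed.

Lemma cosh0 : cosh (0 : R) = 1.
Proof. by rewrite /cosh oppr0 expR0; lra. Qed.

Lemma cosh_addB u v : cosh (u - v) + cosh (u + v) = 2 * cosh u * cosh v.
Proof.
rewrite /cosh !opprD !opprK !expRD; lra.
Qed.

Lemma cosh2_sinh2 t : cosh t ^+ 2 - sinh t ^+ 2 = 1.
Proof.
have := expRxMexpNx_1 t; rewrite /cosh /sinh => h.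
by transitivity (expR t * expR (- t)); [field|].
Qed.

Lemma cosh_half t : cosh t = 1 + 2 * sinh (t / 2) ^+ 2.
Proof.
have := cosh_addB (t / 2) (t / 2); have := cosh2_sinh2 (t / 2).
by rewrite subrr cosh0 -splitr; nra.
Qed.

Lemma cosh_ge1 t : 1 <= cosh t.
Proof. by rewrite cosh_half lerDl mulr_ge0// sqr_ge0. Qed.

Lemma cosh_gt0 t : 0 < cosh t.
Proof. exact: lt_le_trans (cosh_ge1 t). Qed.

Lemma lt_sinh : {homo @sinh R : t u / t < u}.
Proof.
move=> t u tu; rewrite /sinh.
have : expR t < expR u by rewrite ltr_expR.
have : expR (- u) < expR (- t) by rewrite ltr_expR ltrN2.
lra.
Qed.

Lemma sinh_gt0 t : 0 < t -> 0 < sinh t.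
Proof. by move=> /lt_sinh; rewrite sinh0. Qed.

Lemma sinh_ge0 t : 0 <= t -> 0 <= sinh t.
Proof. by rewrite le_eqVlt => /predU1P[<-|/sinh_gt0/ltW//]; rewrite sinh0. Qed.

Lemma sinh_ge t : 0 <= t -> t <= sinh t.
Proof.
move=> t0; rewrite -subr_ge0.
have d (z : R) :
  is_derive z (1 : R) (fun y : R => sinh y - y) (1 * cosh z - 1) by derive.
have := @ger0_derive1_ndecr R (fun y => sinh y - y) 0 t.
have h : forall x : R, x \in `]0, t[ -> derivable (fun y => sinh y - y) x 1.
  by move=> x _; case: (d x).
move=> /(_ h) /(_ _ _ 0 t); rewrite sinh0 subrr lexx; apply => //.
- move=> x _; rewrite derive1E (@derive_val _ _ _ _ _ _ _ (d x)).
  by rewrite mul1r subr_ge0 cosh_ge1.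
- apply: continuous_subspaceT.
  exact: (is_derive_continuous d).
Qed.

Lemma cosh_ge_sqr t : 1 + t ^+ 2 / 2 <= cosh t.
Proof.
wlog t0 : t / 0 <= t.
  move=> h; have [|/ltW t0] := leP 0 t; first exact: h.
  by rewrite -coshN -sqrrN h// oppr_ge0.
have : t / 2 <= sinh (t / 2) by apply: sinh_ge; rewrite divr_ge0.
rewrite cosh_half; nra.
Qed.

(** Complete the square in c t^2 / 2 - |t| + 1/(2c), after bounding cosh below by its quadratic
    Taylor polynomial. This is how e^(-c cosh t) gets dominated by a multiple of e^(-|t|). *)
Lemma cosh_ge_abs t (c : R) : 0 < c -> `|t| - 1 / (2 * c) <= c * cosh t.
Proof.
move=> c0.
have h : `|t| - 1 / (2 * c) <= c * (t ^+ 2 / 2).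
  rewrite -subr_ge0 -real_normK ?num_real//.
  have -> : c * (`|t| ^+ 2 / 2) - (`|t| - 1 / (2 * c)) =
         (c * `|t| - 1) ^+ 2 / (2 * c).
    by field; rewrite gt_eqF.
  by rewrite divr_ge0 ?sqr_ge0// mulr_ge0// ltW.
apply: (le_trans h); rewrite ler_pM2l//.
by have := cosh_ge_sqr t; lra.
Qed.

Lemma sinh_le_cosh t : `|sinh t| <= cosh t.
Proof.
rewrite ler_norml; have := expR_gt0 t; have := expR_gt0 (- t).
rewrite /sinh /cosh; lra.
Qed.

Lemma cosh_le_expR t : cosh t <= expR `|t|.
Proof.
wlog t0 : t / 0 <= t.
  move=> h; have [|/ltW t0] := leP 0 t; first exact: h.
  by rewrite -coshN -normrN h// oppr_ge0.
rewrite ger0_norm// /cosh.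
have : expR (- t) <= expR t by rewrite ler_expR; lra.
lra.
Qed.

Lemma sinh_le_expR t : sinh t <= expR t / 2.
Proof. by rewrite /sinh; have := expR_gt0 (- t); lra. Qed.

End hyperbolic_functions.

(** * Changes of variables on the line *)

(** The image of Lebesgue measure under s -> a s + c, scaled by a, gives each half-open interval its
    length, so it is Lebesgue measure by uniqueness. *)
Lemma ge0_integral_affine {R : realType} (a c : R) (f : R -> \bar R) :
  0 < a -> measurable_fun setT f -> (forall x, 0 <= f x)%E ->
  (\int[@lebesgue_measure R]_x f x =
   a%:E * \int[@lebesgue_measure R]_x f (a * x + c)%R)%E.
Proof.
move=> a0 mf f0.
pose phi := (fun s : measurableTypeR R => (a * s + c)%R : measurableTypeR R).
have mphi : measurable_fun setT phi.
  apply: (@measurable_funD _ _ R setT (fun s => a * s)%R (cst c)) => //.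
  exact: (@measurable_funM _ _ R setT (cst a) (fun s => s)%R).
pose nu0 := mscale (NngNum (ltW a0)) (pushforward (@lebesgue_measure R) phi).
pose nu : {measure set (measurableTypeR R) -> \bar R} := nu0 mphi.
transitivity (\int[nu]_x (f : measurableTypeR R -> \bar R) x)%E.
  apply: eq_measure_integral => X mX _.
  apply: (@lebesgue_measure_unique R nu _ X mX).
  move=> _ [[u v]] _ <- /=.
  rewrite /nu /nu0 /mscale /= /pushforward /=.
  have -> : phi @^-1` `]u, v]%classic =
     `](u - c) / a, (v - c) / a]%classic.
    apply/seteqP; split => x /=; rewrite !in_itv/= ltr_pdivrMr// ler_pdivlMr//
      ltrBlDr lerBrDr mulrC /phi//.
  rewrite !lebesgue_measure_itv/= !lte_fin ltr_pM2r ?invr_gt0// ltrD2r.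
  case: ifPn => uv; last by rewrite mule0.
  by rewrite -!EFinB -EFinM; congr EFin; field; rewrite gt_eqF.
rewrite ge0_integral_mscale//=.
by rewrite ge0_integral_pushforward.
Qed.

(** Two affine substitutions in one variable, linked by Tonelli: t = 2 v + s for fixed s, which
    yields the Jacobian 2, then s = u - v for fixed v. *)
Lemma ge0_integral_rotation {R : realType} (F : R * R -> \bar R) :
  measurable_fun setT F -> (forall z, 0 <= F z)%E ->
  (\int[@lebesgue_measure R \x @lebesgue_measure R]_z F z =
   2%:E * \int[@lebesgue_measure R \x @lebesgue_measure R]_z
     F (z.1 - z.2, z.1 + z.2)%R)%E.
Proof.
move=> mF F0.
have m1 : measurable_fun setT (fun z : R * R => F (z.1, 2 * z.2 + z.1)).
  apply: (measurableT_comp mF); apply: measurable_fun_pair => //.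
  apply: measurable_funD => //.
  by apply: measurable_funM => //; exact: measurable_cst.
have m2 : measurable_fun setT (fun z : R * R => F (z.1 - z.2, z.1 + z.2)).
  apply: (measurableT_comp mF); apply: measurable_fun_pair => //.
    exact: measurable_funB.
  exact: measurable_funD.
rewrite fubini_tonelli1//= /fubini_F.
transitivity (\int[@lebesgue_measure R]_s
  (2%:E * \int[@lebesgue_measure R]_t F (s, 2 * t + s)%R))%E.
  apply: eq_integral => s _.
  apply: (@ge0_integral_affine _ 2 s (fun y => F (s, y))) => //.
  exact: (measurableT_comp mF).
rewrite ge0_integralZl//; first last.
- by move=> s _; exact: integral_ge0.
- exact: (measurable_fun_fubini_tonelli_F (m2 := @lebesgue_measure R) _ m1).
congr (_ * _)%E.
transitivity (\int[@lebesgue_measure R]_v \int[@lebesgue_measure R]_u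
    F (u - v, u + v)%R)%E; last first.
  exact/esym/(fubini_tonelli2 (m1 := @lebesgue_measure R)
    (m2 := @lebesgue_measure R) _ m2).
transitivity (\int[@lebesgue_measure R]_v \int[@lebesgue_measure R]_s
    F (s, 2 * v + s)%R)%E.
  exact: (fubini_tonelli (m1 := @lebesgue_measure R)
    (m2 := @lebesgue_measure R) _ m1).
apply: eq_integral => v _.
rewrite (@ge0_integral_affine _ 1 (- v) (fun s => F (s, 2 * v + s)))//.
  rewrite mul1e; apply: eq_integral => u _; rewrite mul1r.
  by congr (F (_, _)); rewrite mulr_natl mulr2n addrCA addrK.
apply: (measurableT_comp mF); apply: measurable_fun_pair => //.
exact: measurable_funD.
Qed.

Section integrals_over_the_line.
Context {R : realType}.
Local Notation mu := (@lebesgue_measure R).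
Local Open Scope ereal_scope.

Lemma integral_rotation (F : R * R -> \bar R) :
  (mu \x mu).-integrable setT F ->
  \int[mu \x mu]_z F z =
  2%:E * \int[mu \x mu]_z F (z.1 - z.2, z.1 + z.2)%R.
Proof.
move=> iF.
have mF : measurable_fun setT F by exact: measurable_int iF.
(* Finiteness passes to the rotated integrals, which allows the factor 2 to be distributed over the
   difference of the positive and negative parts. *)
have F2 G : measurable_fun setT G -> (forall z, 0 <= G z) ->
    \int[mu \x mu]_z G z \is a fin_num ->
    \int[mu \x mu]_z G (z.1 - z.2, z.1 + z.2)%R \is a fin_num.
  move=> mG G0; rewrite ge0_integral_rotation//.
  rewrite !ge0_fin_numE; [|exact: integral_ge0|by rewrite mule_ge0// integral_ge0].
  by apply: contraTT; rewrite -!leNgt !leye_eq => /eqP ->; rewrite gt0_muley.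
rewrite integralE (ge0_integral_rotation (measurable_funepos mF))//.
rewrite (ge0_integral_rotation (measurable_funeneg mF))//.
rewrite [X in _ = _ * X]integralE [RHS]muleBr//.
  by congr (_ * _ - _ * _); apply: eq_integral => z _; rewrite ?funeposE ?funenegE.
apply: fin_num_adde_defl; rewrite fin_numN.
have h : \int[mu \x mu]_z F^\- (z.1 - z.2, z.1 + z.2)%R \is a fin_num.
  apply: (F2 F^\-) => //; first exact: measurable_funeneg.
  exact: integrable_neg_fin_num.
apply: (eq_ind _ (fun x => x \is a fin_num) h).
by apply: eq_integral => z _; rewrite !funenegE.
Qed.

Lemma ge0_integral_even (f : R -> \bar R) : measurable_fun setT f ->
  (forall t, 0 <= f t) -> (forall t, f (- t)%R = f t) ->
  \int[mu]_t f t = 2%:E * \int[mu]_(t in `[0%R, +oo[) f t.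
Proof.
move=> mf f0 ef; rewrite mule_natl mule2n.
have -> : [set: R] = (`]-oo, 0%R[ `|` `[0%R, +oo[)%classic.
  apply/seteqP; split => // t _ /=; rewrite !in_itv/= andbT.
  by apply/orP; case: ltP.
rewrite ge0_integral_setU//=; first last.
- apply/disj_setPS => t /= []; rewrite !in_itv/= andbT => h1 h2.
  by move: (lt_le_trans h1 h2); rewrite ltxx.
- exact: measurable_funTS.
congr (_ + _); rewrite integral_itv_bndo_bndc; last exact: measurable_funTS.
by rewrite ge0_integration_by_substitution0//; apply: eq_integral => t _; rewrite ef.
Qed.

Lemma integral_even (f : R -> \bar R) : mu.-integrable setT f ->
  (forall t, f (- t)%R = f t) ->
  \int[mu]_t f t = 2%:E * \int[mu]_(t in `[0%R, +oo[) f t.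
Proof.
move=> fi ef; have mf : measurable_fun setT f by exact: measurable_int fi.
rewrite integralE [X in _ = _ * X]integralE.
rewrite (ge0_integral_even (measurable_funepos mf))//; last first.
  by move=> t; rewrite !funeposE ef.
rewrite (ge0_integral_even (measurable_funeneg mf))//; last first.
  by move=> t; rewrite !funenegE ef.
rewrite [RHS]muleBr//; apply: fin_num_adde_defl; rewrite fin_numN.
rewrite integrable_neg_fin_num//.
by apply: integrableS fi.
Qed.

End integrals_over_the_line.

(** * Integrability and improper integrals *)

Section measurability.
Context {d : measure_display} {T : measurableType d} {R : realType}.
Implicit Types f : T -> R.

Lemma measurable_expR_comp f :
  measurable_fun setT f -> measurable_fun setT (fun z => expR (f z)).
Proof. by move=> mf; exact: (measurableT_comp (@measurable_expR R)). Qed.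

Lemma measurable_cos_comp f :
  measurable_fun setT f -> measurable_fun setT (fun z => cos (f z)).
Proof.
move=> mf; apply: measurableT_comp mf; apply: continuous_measurable_fun.
exact: continuous_cos.
Qed.

Lemma measurable_sin_comp f :
  measurable_fun setT f -> measurable_fun setT (fun z => sin (f z)).
Proof.
move=> mf; apply: measurableT_comp mf; apply: continuous_measurable_fun.
exact: continuous_sin.
Qed.

Lemma measurable_cosh_comp f :
  measurable_fun setT f -> measurable_fun setT (fun z => cosh (f z)).
Proof.
move=> mf; apply: measurableT_comp mf; apply: continuous_measurable_fun.
exact: continuous_cosh.
Qed.

Lemma measurable_sinh_comp f :
  measurable_fun setT f -> measurable_fun setT (fun z => sinh (f z)).
Proof.
move=> mf; apply: measurableT_comp mf; apply: continuous_measurable_fun.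
exact: continuous_sinh.
Qed.

Lemma measurable_powR_comp f (p : R) :
  measurable_fun setT f -> measurable_fun setT (fun z => f z `^ p).
Proof. by move=> mf; exact: (measurableT_comp (measurable_powR p)). Qed.

Lemma measurable_normr_comp f :
  measurable_fun setT f -> measurable_fun setT (fun z => `|f z|).
Proof. by move=> mf; exact: (measurableT_comp (@normr_measurable R setT)). Qed.

End measurability.

Ltac measurability :=
  repeat first
    [ assumption | exact: measurable_cst | exact: measurable_id
    | exact: measurable_fst | exact: measurable_snd
    | apply: measurable_expR_comp | apply: measurable_cos_comp
    | apply: measurable_sin_comp | apply: measurable_cosh_comp
    | apply: measurable_sinh_comp | apply: measurable_powR_comp
    | apply: measurable_normr_comp
    | apply: measurable_funM | apply: measurable_funB
    | apply: measurable_funN | apply: measurable_funD ].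

Section integrability.
Context {R : realType}.
Local Notation mu := (@lebesgue_measure R).
Implicit Types (a c : R) (f : R -> R).

Lemma integral_expR_0y a : 0 < a ->
  (\int[mu]_(t in `[0%R, +oo[) (expR (- (a * t)))%:E = (a^-1)%:E)%E.
Proof.
move=> a0.
have d (t : R) : is_derive t 1 (fun t => - a^-1 * expR (- (a * t)))
    (expR (- (a * t))).
  have dm : is_derive t (1 : R) (fun t => - a^-1 * expR (- (a * t)))
    (- a^-1 * ((- (a * 1 + t * 0)) * expR (- (a * t))) +
      expR (- (a * t)) * 0) by derive.
  apply: (is_derive_eq dm); rewrite !mulr0 !addr0 mulr1 mulrA mulrNN.
  by rewrite mulVf ?mul1r// gt_eqF.
have c : continuous (fun t => expR (- (a * t))).
  have dd (t : R) : is_derive t (1 : R) (fun t => expR (- (a * t)))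
    ((- (a * 1 + t * 0)) * expR (- (a * t))) by derive.
  exact: (is_derive_continuous dd).
rewrite (@ge0_continuous_FTC2y _ _ (fun t => - a^-1 * expR (- (a * t))) _ 0).
- by rewrite mulr0 oppr0 expR0 mulr1 -EFinB sub0r opprK.
- by move=> t _; exact: expR_ge0.
- exact: continuous_subspaceT.
- rewrite -(mulr0 (- a^-1)); apply: cvgMr.
  apply: (@cvg_comp _ _ _ (fun z => a * z) (fun z => expR (- z)) _ (pinfty_nbhs R));
    last exact: cvgr_expR.
  exact: gt0_cvgMry.
- by move=> t _; case: (d t).
- apply: cvg_at_right_filter; exact: (is_derive_continuous d).
- by move=> t _; rewrite derive1E; apply: derive_val.
Qed.

Lemma integral_expR_abs a : 0 < a ->
  (\int[mu]_t (expR (- (a * `|t|)))%:E = (2 / a)%:E)%E.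
Proof.
move=> a0; rewrite ge0_integral_even.
- rewrite EFinM; congr (_ * _)%E; rewrite -integral_expR_0y//.
  apply: eq_integral => t; rewrite inE/= in_itv/= andbT => t0.
  by rewrite ger0_norm.
- by apply/measurable_EFinP; measurability.
- by move=> t; rewrite lee_fin expR_ge0.
- by move=> t; rewrite normrN.
Qed.

Lemma integrable_expR_abs a : 0 < a ->
  mu.-integrable setT (fun t => (expR (- (a * `|t|)))%:E).
Proof.
move=> a0; apply/integrableP; split.
  by apply/measurable_EFinP; measurability.
under eq_integral do rewrite /= ger0_norm ?expR_ge0//.
by rewrite integral_expR_abs// ltry.
Qed.

Lemma integrable_le_expR_abs f (C : R) a : 0 < a -> measurable_fun setT f ->
  (forall t, `|f t| <= C * expR (- (a * `|t|))) ->
  mu.-integrable setT (fun t => (f t)%:E).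
Proof.
move=> a0 mf fC.
have := integrableZl measurableT C (integrable_expR_abs a0).
apply: le_integrable => //; first exact/measurable_EFinP.
by move=> t _; rewrite -EFinM lee_fin (le_trans (fC t))// ler_norm.
Qed.

Lemma integrable_expR_cosh c : 0 < c ->
  mu.-integrable setT (fun t => (expR (- (c * cosh t)))%:E).
Proof.
move=> c0; apply: (@integrable_le_expR_abs _ (expR (1 / (2 * c))) 1) => //.
  by measurability.
move=> t; rewrite ger0_norm ?expR_ge0// -expRD ler_expR.
by have := cosh_ge_abs t c0; lra.
Qed.

Lemma integrable_le_expR_cosh f (C c : R) : 0 < c -> measurable_fun setT f ->
  (forall t, `|f t| <= C * expR (- (c * cosh t))) ->
  mu.-integrable setT (fun t => (f t)%:E).
Proof.
move=> a0 mf fC.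
have := integrableZl measurableT C (integrable_expR_cosh a0).
apply: le_integrable => //; first exact/measurable_EFinP.
by move=> t _; rewrite -EFinM lee_fin (le_trans (fC t))// ler_norm.
Qed.

(** By Tonelli the integral of the majorant is the square of a finite integral in one variable. *)
Lemma integrable_prod_expR_cosh (F : R * R -> R) c : 0 < c ->
  measurable_fun setT F ->
  (forall z, `|F z| <= expR (- (c * cosh z.1)) * expR (- (c * cosh z.2))) ->
  (mu \x mu)%E.-integrable setT (fun z => (F z)%:E).
Proof.
move=> c0 mF Fc.
have i1 := integrable_expR_cosh c0.
have mEF : measurable_fun setT (fun z => (F z)%:E) by exact/measurable_EFinP.
apply/(@integrable12ltyP _ _ _ _ R mu mu _ mEF).
apply: (@le_lt_trans _ _ (\int[mu]_x ((expR (- (c * cosh x)))%:E *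
   \int[mu]_y (expR (- (c * cosh y)))%:E)%E)%E).
  apply: ge0_le_integral => //.
  - by move=> x _; exact: integral_ge0.
  - apply: (measurable_fun_fubini_tonelli_F (m2 := mu)
      (fun z => `|(F z)%:E|%E)) => //.
    exact: measurableT_comp.
  - apply: emeasurable_funM => //.
    by apply/measurable_EFinP; measurability.
  - move=> x _; rewrite -ge0_integralZl//; last by apply/measurable_EFinP; measurability.
    apply: ge0_le_integral => //.
    + apply: measurableT_comp; first exact: abse_measurable.
      exact: measurableT_comp mEF _.
    + apply: emeasurable_funM => //.
      by apply/measurable_EFinP; measurability.
    + by move=> y _; rewrite /= -EFinM lee_fin (Fc (x, y)).
rewrite ge0_integralZr//; first last.
- by apply: integral_ge0 => x _; rewrite lee_fin expR_ge0.
- by apply/measurable_EFinP; measurability.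
have := integrable_fin_num measurableT i1.
by move=> /fineK <-; rewrite -EFinM ltry.
Qed.

(** Dominated convergence with majorant |f|. Eventual agreement of membership at each point covers
    both [-n, n] growing to the line and [0, n] growing to the half-line. *)
Lemma cvg_integral_exhaust (f : R -> \bar R) (D_ : nat -> set R) (D : set R) :
  mu.-integrable setT f -> (forall n, measurable (D_ n)) -> measurable D ->
  (forall t, \forall n \near \oo, (t \in D_ n) = (t \in D)) ->
  (\int[mu]_(t in D_ n) f t @[n --> \oo] --> \int[mu]_(t in D) f t)%E.
Proof.
move=> fi mD_ mD D_D.
have mf : measurable_fun setT f by exact: measurable_int fi.
have -> : (fun n => \int[mu]_(t in D_ n) f t)%E =
    (fun n => \int[mu]_t (f \_ (D_ n)) t)%E.
  by apply/funext => n; rewrite integral_mkcond.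
have -> : (\int[mu]_(t in D) f t)%E = (\int[mu]_t (f \_ D) t)%E.
  by rewrite integral_mkcond.
have [] := @dominated_convergence _ _ _ mu setT measurableT
  (fun n => f \_ (D_ n)) (f \_ D) (abse \o f).
- by move=> n; apply/(measurable_restrictT _ (mD_ n)); exact: measurable_funTS mf.
- by apply/(measurable_restrictT _ mD); exact: measurable_funTS mf.
- apply/aeW => t _; apply: cvg_near_cst; near=> n.
  by rewrite /patch (_ : (t \in D_ n) = (t \in D))//; near: n; exact: D_D.
- exact: integrable_abse.
- by apply/aeW => t n _; rewrite /patch /=; case: ifP => //; rewrite abse0.
by [].
Unshelve. all: end_near. Qed.

End integrability.

Section improper.
Context {R : realType}.
Local Notation mu := (@lebesgue_measure R).
Implicit Types (a c : R) (f : R -> R).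

(** The integral over [-n, n] is F(n) - F(-n), which tends to 0, and these intervals exhaust the
    line. *)
Lemma integral_derive_vanishing (F f : R -> R) :
  (forall t : R, is_derive t 1 F (f t)) -> continuous f ->
  mu.-integrable setT (EFin \o f) ->
  F n%:R @[n --> \oo] --> 0 -> F (- n%:R) @[n --> \oo] --> 0 ->
  (\int[mu]_t (f t)%:E = 0)%E.
Proof.
move=> dF cf fi Fp Fm.
have cF : continuous F by exact: (is_derive_continuous dF).
have h : (\int[mu]_(t in `[(- n%:R)%R, n%:R]) (f t)%:E @[n --> \oo] -->
    \int[mu]_t (f t)%:E)%E.
  apply: cvg_integral_exhaust => // t; near=> n.
  apply/idP/idP; first by rewrite in_setT.
  move=> _; rewrite inE/= in_itv/= -ler_norml.
  by near: n; exact: nbhs_infty_ger.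
apply/esym; apply: (cvg_unique _ _ h) => //.
have E : \forall n \near \oo, (F n%:R - F (- n%:R))%:E =
    (\int[mu]_(t in `[(- n%:R)%R, n%:R]) (f t)%:E)%E.
  near=> n.
  have n0 : (0 < n)%N by near: n; exists 1%N.
  rewrite (@continuous_FTC2 _ f F) -?EFinB//.
  - by rewrite (@lt_trans _ _ 0)// ?oppr_lt0 ltr0n.
  - exact: continuous_subspaceT.
  - split.
    + by move=> t _; case: (dF t).
    + by apply: cvg_at_right_filter; exact: cF.
    + by apply: cvg_at_left_filter; exact: cF.
  - by move=> t _; rewrite derive1E; apply: derive_val.
apply: cvg_trans; first exact: near_eq_cvg E.
apply: cvg_EFin; first exact: nearW.
by rewrite -[X in _ --> X](subr0 0); exact: cvgB.
Unshelve. all: end_near. Qed.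

End improper.

(** * The oscillatory integral over v *)

Section oscillatory.
Context {R : realType}.
Local Notation mu := (@lebesgue_measure R).

(** The difference of [M] and the primitive of [F] has derivative [M' - F], which is nonnegative, so
    it is nondecreasing. An integral is thus bounded by exhibiting an explicit function whose
    derivative dominates the integrand. *)
Lemma le_increment_integral (F M M' : R -> R) (x y : R) : continuous F ->
  0 <= x -> x <= y ->
  (forall t : R, x <= t <= y -> is_derive t 1 M (M' t)) ->
  (forall t : R, x <= t <= y -> F t <= M' t) ->
  (\int[mu]_(t in `[0%R, y]) F t)%R - (\int[mu]_(t in `[0%R, x]) F t)%R <=
  M y - M x.
Proof.
move=> cF x0 xy dM FM.
pose G := parameterized_integral mu 0 ^~ F.
rewrite -/(G y) -/(G x).
have y0 : 0 <= y by exact: le_trans xy.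
have iF (u : R) : mu.-integrable `[0, u] (EFin \o F).
  apply: continuous_compact_integrable; first exact: segment_compact.
  exact: continuous_subspaceT.
have dG (t : R) : x < t < y -> is_derive t 1 G (F t).
  rewrite ?in_itv/= => /andP[xt ty].
  have [dG GE] := continuous_FTC1_closed ty (iF y) (le_lt_trans x0 xt) (cF t).
  by apply: DeriveDef; [exact: dG|rewrite -derive1E GE].
have dH (t : R) : x < t < y -> is_derive t 1 (fun t => M t - G t) (M' t - F t).
  move=> tx; apply: is_derive_add; last by apply: is_derive_opp; exact: dG.
  by apply: dM; move: tx => /andP[/ltW -> /ltW].
have key (p q r s : R) : r - p <= s - q -> q - p <= s - r by lra.
apply: key.
apply: (@ger0_derive1_ndecr R (fun t => M t - G t) x y) => //.
- by move=> t tx; case: (dH t _).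
- move=> t tx; rewrite derive1E (@derive_val _ _ _ _ _ _ _ (dH t _)) ?subr_ge0//.
  by apply: FM; move: tx; rewrite in_itv/= => /andP[/ltW -> /ltW].
- apply: (@within_continuousB _ _ R) => //.
    apply: derivable_within_continuous => t; rewrite in_itv/= => tx.
    by case: (dM t tx).
  apply: continuous_subspaceW (parameterized_integral_continuous y0 (iF y)).
  by move=> t /=; rewrite !in_itv/= => /andP[xt ->]; rewrite (le_trans x0 xt).
Qed.

(** With q = a^2 + b^2, both X^2 and b^2 are at most q, hence (b X)^2 <= q^2. This serves for the
    primitive [P] of the next proof, whose numerator satisfies the hypothesis by Cauchy-Schwarz. *)
Lemma abs_primitive_le (a b X : R) : 0 < b -> X ^+ 2 <= a ^+ 2 + b ^+ 2 ->
  `|X / (a ^+ 2 + b ^+ 2)| <= b^-1.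
Proof.
move=> b0 hX; set q := a ^+ 2 + b ^+ 2 in hX *.
have bq : b ^+ 2 <= q by rewrite lerDr sqr_ge0.
have q0 : 0 < q by apply: lt_le_trans bq; rewrite exprn_gt0.
rewrite normrM normfV (gtr0_norm q0) ler_pdivrMr// mulrC ler_pdivlMr//.
rewrite -(@ler_pXn2r _ 2%N)// ?nnegrE ?mulr_ge0 ?(ltW b0) ?(ltW q0)//.
by rewrite exprMn real_normK ?num_real// (expr2 q) ler_pM// sqr_ge0.
Qed.

(** A van der Corput estimate: in the variable w = cosh v the integrand has a primitive bounded by
    1/b, and the Jacobian 1 / sinh v is harmless away from v = 0. The half-line is cut at [delta],
    and the bound on the line is 2 [delta]. The result is uniform in [a] and [phi]. *)
Lemma integral_oscillatory_le (a b phi : R) : 0 < a -> 0 < b ->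
  (\int[mu]_v (expR (- (a * cosh v)) * cos (phi - b * cosh v))%:E <=
   (4 / Num.sqrt b)%:E)%E.
Proof.
move=> a0 b0.
pose q := a ^+ 2 + b ^+ 2.
have q0 : 0 < q by rewrite addr_gt0// exprn_gt0.
pose p (w : R) := expR (- (a * w)) * cos (phi - b * w).
(* [P] is the real part of - e^(-(a + i b) w + i phi) / (a + i b), a primitive of [p]. *)
pose P (w : R) := expR (- (a * w)) *
  ((- a * cos (phi - b * w) - b * sin (phi - b * w)) * q^-1).
pose F v := p (cosh v).
have dP (w : R) : is_derive w 1 P (p w).
  rewrite /P; derive_to; rewrite /p /q; field.
  by rewrite gt_eqF.
have Pb (w : R) : 0 <= w -> `|P w| <= b^-1.
  move=> w0; rewrite /P normrM -[leRHS]mul1r ler_pM//.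
    by rewrite ger0_norm ?expR_ge0// expR_le1 oppr_le0 mulr_ge0// ltW.
  apply: abs_primitive_le => //.
  have := cos2Dsin2 (phi - b * w).
  move: (cos _) (sin _) => co si h.
  suff : 0 <= (a * si - b * co) ^+ 2 by move: h; rewrite /q; nra.
  exact: sqr_ge0.
have dPc (v : R) : is_derive v 1 (fun v => P (cosh v)) (sinh v * F v).
  have dc : is_derive v 1 (@cosh R) (sinh v).
    have := is_derive_cosh_comp (is_derive_var v).
    by rewrite mul1r.
  by rewrite mulrC; exact: (is_derive1_comp (dP (cosh v)) dc).
have F1 v : F v <= 1.
  apply: (le_trans (ler_norm _)); rewrite /F /p normrM -[leRHS]mulr1 ler_pM//.
    by rewrite ger0_norm ?expR_ge0// expR_le1 oppr_le0 mulr_ge0// ltW// cosh_gt0.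
  exact: cos_max.
have cF : continuous F.
  move=> v; apply/differentiable_continuous/derivable1_diffP.
  by rewrite /F /p; eapply ex_derive; repeat derive_step.
have sb0 : 0 < Num.sqrt b by rewrite sqrtr_gt0.
(* The cut is chosen so that delta^2 / 2 = 2/b; by the quadratic lower bound cosh delta - 1 is then
   at least 2/b, twice the bound on |P|. *)
have [delta [deltaE d0 Cd]] : exists delta,
    [/\ delta = 2 / Num.sqrt b, 0 < delta & 1 + 2 * b^-1 <= cosh delta].
  exists (2 / Num.sqrt b); split => //; first by rewrite divr_gt0.
  apply: le_trans (cosh_ge_sqr _); rewrite lerD2l.
  rewrite expr_div_n sqr_sqrtr ?(ltW b0)//.
  by rewrite le_eqVlt; apply/orP; left; apply/eqP; field; rewrite gt_eqF.
have S0 : 0 < sinh delta by exact: sinh_gt0.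
pose G N := (\int[mu]_(t in `[0%R, N]) F t)%R.
(* On [0, delta] the majorant of [F] sharpens the trivial bound 1: it comes from (1 - F v)(1 - sinh
   v / sinh delta) >= 0, and it has an explicit primitive because sinh v * F v is the derivative of
   P (cosh v). *)
have G1 : G delta - G 0 <=
    (delta + (P (cosh delta) - cosh delta) * (sinh delta)^-1) -
    (0 + (P (cosh 0) - cosh 0) * (sinh delta)^-1).
  apply: (@le_increment_integral F
    (fun v => v + (P (cosh v) - cosh v) * (sinh delta)^-1)
    (fun v => 1 + (sinh v * F v - sinh v) * (sinh delta)^-1) _ _ cF (lexx 0)
    (ltW d0)).
  - move=> v _.
    have dm : is_derive v (1 : R)
      (fun v => v + (P (cosh v) - cosh v) * (sinh delta)^-1)
      (1 + ((P (cosh v) - cosh v) * 0 +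
         (sinh delta)^-1 * (sinh v * F v - 1 * sinh v))).
      by repeat first [exact: dPc | derive_step].
    by apply: (is_derive_eq dm); ring.
  - move=> v /andP[v0 vd].
    have r1 : sinh v / sinh delta <= 1.
      rewrite ler_pdivrMr// mul1r; move: vd; rewrite le_eqVlt.
      by move=> /predU1P[->//|/lt_sinh/ltW].
    have : 0 <= (1 - F v) * (1 - sinh v / sinh delta).
      by rewrite mulr_ge0// subr_ge0.
    by lra.
(* Beyond [delta], integrate by parts against 1 / sinh v. Subtracting 1/b from [P] makes it
   nonpositive, so the remaining term has a favourable sign. *)
have G2 N : delta <= N -> G N - G delta <=
    (P (cosh N) - b^-1) * (sinh N)^-1 -
    (P (cosh delta) - b^-1) * (sinh delta)^-1.
  move=> dN; apply: (@le_increment_integral F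
    (fun v => (P (cosh v) - b^-1) * (sinh v)^-1)
    (fun v => F v - (P (cosh v) - b^-1) * cosh v / sinh v ^+ 2) _ _ cF (ltW d0) dN).
  - move=> v /andP[dv vN].
    have s0 : 0 < sinh v by apply: sinh_gt0; exact: lt_le_trans dv.
    have dm : is_derive v (1 : R)
      (fun v => (P (cosh v) - b^-1) * (sinh v)^-1)
      ((P (cosh v) - b^-1) * (- (1 * cosh v) / sinh v ^+ 2) +
         (sinh v)^-1 * (sinh v * F v + 0)).
      apply: is_derive_mul.
        repeat first [exact: dPc | derive_step].
      apply: is_derive_inv; first by rewrite gt_eqF.
      by repeat derive_step.
    by apply: (is_derive_eq dm); field; rewrite !gt_eqF.
  - move=> v /andP[dv vN]; rewrite lerDl oppr_ge0.
    rewrite mulr_le0_ge0 ?invr_ge0 ?sqr_ge0//.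
    rewrite mulr_le0_ge0 ?(ltW (cosh_gt0 _))// subr_le0.
    by rewrite (le_trans (ler_norm _))// Pb// ltW// cosh_gt0.
have G00 : G 0 = 0 by rewrite /G set_itv1 Rintegral_set1.
have GN N : delta <= N -> G N <= delta.
  move=> dN; have {}G2 := G2 N dN.
  have M2 : (P (cosh N) - b^-1) * (sinh N)^-1 <= 0.
    rewrite mulr_le0_ge0 ?invr_ge0 ?sinh_ge0 ?(le_trans (ltW d0))//.
    by rewrite subr_le0 (le_trans (ler_norm _))// Pb// ltW// cosh_gt0.
  have P1 : - b^-1 <= P 1.
    by have := Pb 1 ler01; rewrite ler_norml => /andP[].
  (* When the two increments are added, the terms in [P (cosh delta)] cancel. What remains besides
     [delta] is nonpositive because - P 1 <= 1/b and cosh delta >= 1 + 2/b. *)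
  have : (b^-1 - P 1 - cosh delta + 1) * (sinh delta)^-1 <= 0.
    by rewrite mulr_le0_ge0 ?invr_ge0 ?(ltW S0)//; lra.
  by move: G1 G2 M2; rewrite G00 cosh0; lra.
have iF : mu.-integrable setT (EFin \o F).
  apply: (@integrable_le_expR_cosh _ _ 1 a) => //.
    by rewrite /F /p; measurability.
  move=> v; rewrite /F /p normrM ger0_norm ?expR_ge0// mulrC ler_pM//.
  exact: cos_max.
rewrite (integral_even iF)/=; last by move=> v; rewrite /F coshN.
have -> : (4 / Num.sqrt b)%:E = (2%:E * delta%:E)%E.
  by rewrite -EFinM deltaE; congr EFin; ring.
rewrite lee_pmul2l//.
have h : (\int[mu]_(t in `[0%R, n%:R]) (F t)%:E @[n --> \oo] -->
    \int[mu]_(t in `[0%R, +oo[) (F t)%:E)%E.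
  apply: cvg_integral_exhaust => // t; near=> n.
  have tn : t <= n%:R by near: n; exact: nbhs_infty_ger.
  by apply/idP/idP => /set_mem /=; rewrite in_itv/= ?tn ?andbT => ht;
    apply/mem_set; rewrite /= in_itv/= ?tn ?andbT.
rewrite -(cvg_lim _ h)//; apply: lime_le; first by apply/cvg_ex; eexists; exact: h.
near=> n.
have iFn : mu.-integrable `[0, n%:R] (EFin \o F) by exact: integrableS iF.
rewrite -[leLHS]fineK ?integrable_fin_num// lee_fin.
by apply: GN; near: n; exact: nbhs_infty_ger.
Unshelve. all: end_near. Qed.

(** The one-sided bound holds for every phase: replacing phi by phi + pi changes the sign of the
    integral and gives the lower bound. Parity of the cosine reduces b < 0 to b > 0. *)
Lemma abs_integral_oscillatory_le (a b phi : R) : 0 < a -> b != 0 ->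
  `|\int[mu]_v (expR (- (a * cosh v)) * cos (phi - b * cosh v))| <=
  4 / Num.sqrt `|b|.
Proof.
move=> a0.
wlog b0 : b phi / 0 < b => [hw b0|_].
  have [b1|b1] := ltP 0 b; first exact: hw.
  have b2 : 0 < - b by rewrite oppr_gt0 lt_neqAle b0.
  have -> : (fun v => expR (- (a * cosh v)) * cos (phi - b * cosh v)) =
      (fun v => expR (- (a * cosh v)) * cos (- phi - (- b) * cosh v)).
    apply/funext => v; rewrite -[in RHS]cosN; congr (_ * cos _); ring.
  by rewrite -(normrN b); apply: (hw (- b) (- phi)) => //; rewrite oppr_eq0.
rewrite (gtr0_norm b0).
pose F phi v := expR (- (a * cosh v)) * cos (phi - b * cosh v).
have iF phi' : mu.-integrable setT (EFin \o F phi').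
  apply: (@integrable_le_expR_cosh _ _ 1 a) => //.
    by rewrite /F; measurability.
  move=> v; rewrite /F normrM ger0_norm ?expR_ge0// mulrC ler_pM//.
  exact: cos_max.
have U phi' : \int[mu]_v F phi' v <= 4 / Num.sqrt b.
  rewrite -lee_fin fineK; first exact: integral_oscillatory_le.
  exact: (integrable_fin_num measurableT (iF _)).
have N : - (\int[mu]_v F phi v) = \int[mu]_v F (phi + pi) v.
  rewrite -mulN1r -RintegralZl//; apply: eq_Rintegral => v _.
  by rewrite /F (addrAC _ pi) cosDpi; ring.
by rewrite ler_norml U andbT lerNl N U.
Qed.

End oscillatory.

(** * Shift of the contour *)

Section shift.
Context {R : realType}.
Local Notation mu := (@lebesgue_measure R).
Variables (tau x : R).
Hypotheses (tau0 : 0 <= tau) (x0 : 0 < x).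

(** The real part of e^(-x cosh w + i tau w) at w = t + i y. *)
Let f (y t : R) := expR (- (y * tau) - x * cos y * cosh t) *
  cos (tau * t - x * sin y * sinh t).

Let g (y t : R) := expR (- (y * tau) - x * cos y * cosh t) *
  ((- tau + x * sin y * cosh t) * cos (tau * t - x * sin y * sinh t) +
    x * cos y * sinh t * sin (tau * t - x * sin y * sinh t)).

(** Minus the imaginary part of the same function. By a Cauchy-Riemann equation, [g] is both the
    y-derivative of [f] and the t-derivative of [h]. *)
Let h (y t : R) := - (expR (- (y * tau) - x * cos y * cosh t) *
  sin (tau * t - x * sin y * sinh t)).

Let is_derive_f1 (y t : R) : is_derive y 1 (f ^~ t) (g y t).
Proof. by rewrite /f; derive_to; rewrite /g; ring. Qed.

Let is_derive_h2 (y t : R) : is_derive t 1 (h y) (g y t).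
Proof. by rewrite /h; derive_to; rewrite /g; ring. Qed.

Let continuous_g2 (y : R) : continuous (g y).
Proof.
move=> t; apply/differentiable_continuous/derivable1_diffP.
by rewrite /g; eapply ex_derive; derive.
Qed.

Variable psi : R.
Hypotheses (psi0 : 0 < psi) (psi_pi : psi < pi / 2).

(** The smallest decay rate in the closed strip |y| <= psi; it gives majorants uniform in y. *)
Let k := x * cos psi.

Let k_gt0 : 0 < k.
Proof.
by rewrite mulr_gt0// cos_gt0_pihalf// psi_pi andbT (lt_trans _ psi0)// oppr_lt0
  divr_gt0// pi_gt0.
Qed.

Let cos_psi (y : R) : - psi < y < psi -> cos psi <= cos y.
Proof.
move=> yp; rewrite -(cos_norm y).
have yp' : `|y| <= psi by rewrite ler_norml !ltW//; case/andP: yp.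
have pi0 := pi_gt0 R.
move: yp'; rewrite le_eqVlt => /predU1P[->//|yp'].
have n0 := normr_ge0 y; have p0 := psi0; have p1 := psi_pi.
by apply: ltW; rewrite ltr_cos// in_itv/=; lra.
Qed.

Let exp_le (y t : R) : - psi < y < psi ->
  expR (- (y * tau) - x * cos y * cosh t) <=
  expR (psi * tau) * expR (- (k * cosh t)).
Proof.
move=> yp; rewrite -expRD ler_expR; apply: lerB; last first.
  by rewrite ler_pM2r ?cosh_gt0// ler_pM2l// cos_psi.
by rewrite -mulNr ler_wpM2r// lerNl ltW//; case/andP: yp.
Qed.

Let f_le (y t : R) : - psi < y < psi ->
  `|f y t| <= expR (psi * tau) * expR (- (k * cosh t)).
Proof.
move=> yp; rewrite /f normrM ger0_norm ?expR_ge0// -[leRHS]mulr1.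
by rewrite ler_pM ?expR_ge0// ?cos_max// exp_le.
Qed.

Let h_le (y t : R) : - psi < y < psi ->
  `|h y t| <= expR (psi * tau) * expR (- (k * cosh t)).
Proof.
move=> yp; rewrite /h normrN normrM ger0_norm ?expR_ge0// -[leRHS]mulr1.
by rewrite ler_pM ?expR_ge0// ?sin_max// exp_le.
Qed.

Let C := expR (psi * tau) * ((tau + 2 * x) * (2 / k)).

(** The prefactor of [g] is at most (tau + 2x) cosh t. Half of the decay rate [k] is spent on
    absorbing cosh t, through cosh t <= (2/k) e^((k/2) cosh t). *)
Let g_le (y t : R) : - psi < y < psi ->
  `|g y t| <= C * expR (- (k / 2 * cosh t)).
Proof.
move=> yp; rewrite /g normrM ger0_norm ?expR_ge0//.
have -> : C * expR (- (k / 2 * cosh t)) =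
   (expR (psi * tau) * expR (- (k * cosh t))) *
   ((tau + 2 * x) * (2 / k * expR (k / 2 * cosh t))).
  have -> : expR (- (k / 2 * cosh t)) =
      expR (- (k * cosh t)) * expR (k / 2 * cosh t).
    by rewrite -expRD; congr expR; field.
  by rewrite /C; ring.
rewrite ler_pM ?expR_ge0// ?exp_le//.
have b1 : cosh t <= 2 / k * expR (k / 2 * cosh t).
  have := expR_ge1Dx (k / 2 * cosh t).
  rewrite -(@ler_pM2l _ (2 / k)) ?divr_gt0//; apply: le_trans.
  have -> : 2 / k * (1 + k / 2 * cosh t) = 2 / k + cosh t.
    by field; rewrite gt_eqF.
  by rewrite lerDr divr_ge0 ?ltW.
apply: (@le_trans _ _ ((tau + 2 * x) * cosh t)); last first.
  by rewrite ler_wpM2l// addr_ge0// mulr_ge0// ltW.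
have c1 := cosh_ge1 t.
have b2 : `|(- tau + x * sin y * cosh t) * cos (tau * t - x * sin y * sinh t)| <=
    tau * cosh t + x * cosh t.
  rewrite normrM -[leRHS]mulr1 ler_pM ?cos_max//.
  apply: (le_trans (ler_normD _ _)); rewrite normrN (ger0_norm tau0).
  apply: lerD; first by rewrite -[leLHS]mulr1 ler_wpM2l.
  rewrite normrM (gtr0_norm (cosh_gt0 t)) ler_pM2r ?cosh_gt0// normrM.
  by rewrite (gtr0_norm x0) -[leRHS]mulr1 ler_pM2l// sin_max.
have b3 : `|x * cos y * sinh t * sin (tau * t - x * sin y * sinh t)| <= x * cosh t.
  rewrite normrM -[leRHS]mulr1 ler_pM ?sin_max//.
  rewrite normrM ler_pM ?sinh_le_cosh//.
  by rewrite normrM (gtr0_norm x0) -[leRHS]mulr1 ler_pM2l// cos_max.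
apply: (le_trans (ler_normD _ _)); apply: (le_trans (lerD b2 b3)).
by rewrite le_eqVlt; apply/orP; left; apply/eqP; ring.
Qed.

Let integrable_f (y : R) : - psi < y < psi -> mu.-integrable setT (EFin \o f y).
Proof.
move=> yp; apply: (integrable_le_expR_cosh k_gt0).
  by rewrite /f; measurability.
by move=> t; exact: f_le.
Qed.

Let integrable_g (y : R) : - psi < y < psi -> mu.-integrable setT (EFin \o g y).
Proof.
move=> yp; apply: (@integrable_le_expR_cosh _ _ C (k / 2)); first by rewrite divr_gt0.
  by rewrite /g; measurability.
by move=> t; exact: g_le.
Qed.

(** [g y] is the derivative of [h y], which vanishes at both ends of the line; the sign [s] treats
    the two ends together. *)
Let integral_g (y : R) : - psi < y < psi -> \int[mu]_t g y t = 0.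
Proof.
move=> yp.
have cvgh (s : R) : `|s| = 1 -> h y (s * n%:R) @[n --> \oo] --> 0.
  move=> s1; apply: norm_cvg0.
  pose D := expR (psi * tau) * expR (1 / (2 * k)).
  apply: (@squeeze_cvgr _ _ _ _ (cst 0) (fun n : nat => D * expR (- n%:R))).
  - near=> n; rewrite normr_ge0/= (le_trans (h_le _ yp))// /D -mulrA.
    rewrite ler_pM2l ?expR_gt0// -expRD ler_expR.
    have := cosh_ge_abs (s * n%:R) k_gt0.
    by rewrite normrM s1 mul1r ger0_norm ?ler0n//; lra.
  - exact: cvg_cst.
  - by rewrite -(mulr0 D); apply: cvgMr; exact: cvgn_expR.
rewrite /Rintegral (integral_derive_vanishing (is_derive_h2 y)
  (@continuous_g2 y) (integrable_g yp))//=.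
- have := @cvgh 1; rewrite normr1 => /(_ erefl).
  by under eq_fun do rewrite mul1r.
- have := @cvgh (-1); rewrite normrN1 => /(_ erefl).
  by under eq_fun do rewrite mulN1r.
Unshelve. all: end_near. Qed.

Let J y := \int[mu]_t f y t.

(** Differentiation under the integral sign gives the integral of [g y], which is 0. The strip is
    symmetric so that y = 0 is an interior point. *)
Let is_derive_J (y : R) : - psi < y < psi -> is_derive y 1 J 0.
Proof.
move=> yp.
pose G (t : R) := C * expR (- (k / 2 * cosh t)).
have C0 : 0 <= C.
  by rewrite !mulr_ge0 ?expR_ge0 ?addr_ge0 ?mulr_ge0 ?invr_ge0 ?(ltW x0)
    ?(ltW k_gt0).
have yI : `]- psi, psi[%classic y by rewrite /= in_itv/=.
have h1 (z : R) : `]- psi, psi[%classic z -> mu.-integrable setT (EFin \o f z).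
  by rewrite /= in_itv/=; exact: integrable_f.
have h2 (z t : R) : `]- psi, psi[%classic z -> setT t -> derivable (f ^~ t) z 1.
  by move=> _ _; case: (is_derive_f1 z t).
have h3 t : 0 <= G t by rewrite mulr_ge0 ?expR_ge0.
have h4 : mu.-integrable setT (EFin \o G).
  apply: (@integrable_le_expR_cosh _ _ C (k / 2)); first by rewrite divr_gt0.
    by rewrite /G; measurability.
  by move=> t; rewrite ger0_norm.
have d1 z t : partial1of2 f z t = g z t.
  by rewrite partial1of2E (@derive_val _ _ _ _ _ _ _ (is_derive_f1 z t)).
have h5 (z t : R) : `]- psi, psi[%classic z -> setT t ->
    `|partial1of2 f z t| <= G t.
  by rewrite /= in_itv/= d1 => zp _; exact: g_le.
apply: DeriveDef.
  exact: (derivable_under_integral measurableT yI h1 h2 h3 h4 h5).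
rewrite -derive1E (differentiation_under_integral measurableT yI h1 h2 h3 h4 h5).
by rewrite -[RHS](integral_g yp); apply: eq_Rintegral => t _; exact: d1.
Qed.

Let shift_in_strip (y : R) : 0 <= y < psi -> J y = J 0.
Proof.
rewrite le_eqVlt => /andP[/predU1P[<-//|y0] yp].
have dJ (z : R) : z \in `]0, y[ -> is_derive z 1 J 0.
  rewrite in_itv/= => /andP[z0 zy]; apply: is_derive_J.
  by rewrite (lt_trans _ z0) ?oppr_lt0//= (lt_trans zy).
have cJ : {within `[0, y], continuous J}.
  apply: derivable_within_continuous => z; rewrite in_itv/= => /andP[z0 zy].
  have [] // := @is_derive_J z _.
  by rewrite (lt_le_trans _ z0) ?oppr_lt0//= (le_lt_trans zy).
have [z _] := MVT y0 dJ cJ.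
by rewrite mul0r => /eqP; rewrite subr_eq0 => /eqP.
Qed.

Lemma integral_shift_strip (theta : R) : 0 <= theta < psi ->
  \int[mu]_t (expR (- (theta * tau) - x * cos theta * cosh t) *
    cos (tau * t - x * sin theta * sinh t)) =
  \int[mu]_t (expR (- (x * cosh t)) * cos (tau * t)).
Proof.
move=> /shift_in_strip; rewrite /J => ->; apply: eq_Rintegral => t _.
by rewrite /f cos0 sin0 mul0r oppr0 sub0r mulr1 mulr0 mul0r subr0.
Qed.

End shift.

(* Moving the line of integration from Im t = 0 to Im t = theta. *)
Lemma integral_shift {R : realType} (tau x theta : R) :
  0 <= tau -> 0 < x -> 0 <= theta < pi / 2 ->
  \int[@lebesgue_measure R]_t (expR (- (theta * tau) - x * cos theta * cosh t) *
    cos (tau * t - x * sin theta * sinh t)) =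
  \int[@lebesgue_measure R]_t (expR (- (x * cosh t)) * cos (tau * t)).
Proof.
move=> tau0 x0 /andP[t0 tp].
(* Any half-width strictly between theta and pi/2 would do; the midpoint is taken. *)
apply: (@integral_shift_strip _ _ _ tau0 x0 ((theta + pi / 2) / 2)); lra.
Qed.

(** * Product formula *)

Section product_formula.
Context {R : realType}.
Local Notation mu := (@lebesgue_measure R).
Local Open Scope ereal_scope.

Lemma ge0_integral_opp (f : R -> \bar R) : measurable_fun setT f ->
  (forall t, 0 <= f t) -> \int[mu]_t f (- t)%R = \int[mu]_t f t.
Proof.
move=> mf f0.
transitivity (\int[pushforward mu (-%R : measurableTypeR R -> measurableTypeR R)]_t f t).
  by rewrite ge0_integral_pushforward.
by apply: eq_measure_integral => A mA _; exact: lebesgue_measureN.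
Qed.

Lemma integral_odd (f : R -> \bar R) : mu.-integrable setT f ->
  (forall t, f (- t)%R = - f t) -> \int[mu]_t f t = 0.
Proof.
move=> fi fodd; have mf : measurable_fun setT f by exact: measurable_int fi.
rewrite integralE -(ge0_integral_opp (measurable_funeneg mf))//.
transitivity (\int[mu]_t f^\+ t - \int[mu]_t f^\+ t).
  congr (_ - _); apply: eq_integral => t _.
  by rewrite funeposE funenegE fodd oppeK.
by rewrite subee//; exact: integrable_pos_fin_num.
Qed.

Lemma integrable_macdonald (tau x : R) : (0 < x)%R ->
  mu.-integrable setT (fun t => (expR (- (x * cosh t)) * cos (tau * t))%:E).
Proof.
move=> x0; apply: (@integrable_le_expR_cosh _ _ 1 x) => //.
  by measurability.
move=> t; rewrite normrM ger0_norm ?expR_ge0// mulrC ler_pM//.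
exact: cos_max.
Qed.

Lemma integral_macdonald (tau x : R) : (0 < x)%R ->
  \int[mu]_t (expR (- (x * cosh t)) * cos (tau * t))%:E =
  (2 * macdonald_im tau x)%:E.
Proof.
move=> x0; have fi := integrable_macdonald tau x0.
rewrite (integral_even fi)/=; last by move=> t; rewrite coshN mulrN cosN.
rewrite EFinM /macdonald_im fineK//; apply: integrable_fin_num => //.
by apply: integrableS fi.
Qed.

(** Expand cos (tau s + tau t): the product of cosines gives the square, and the sine term vanishes
    because its integral over t is that of an odd function. *)
Lemma sqr_macdonald (tau x : R) : (0 < x)%R ->
  ((2 * macdonald_im tau x) ^+ 2)%:E = \int[mu \x mu]_z
    (expR (- (x * cosh z.1) - x * cosh z.2) * cos (tau * (z.1 + z.2)))%:E.
Proof.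
move=> x0.
pose F (z : R * R) :=
  (expR (- (x * cosh z.1) - x * cosh z.2) * cos (tau * (z.1 + z.2)))%R.
have mF : measurable_fun setT F by rewrite /F; measurability.
have iF : (mu \x mu).-integrable setT (EFin \o F).
  apply: (integrable_prod_expR_cosh x0 mF) => z.
  rewrite /F normrM ger0_norm ?expR_ge0// -expRD -[leRHS]mulr1.
  by rewrite ler_pM ?expR_ge0// cos_max.
rewrite -(integral12_prod_meas1 iF) /fubini_F.
have iC := integrable_macdonald tau x0.
have iS : mu.-integrable setT
    (fun t => (expR (- (x * cosh t)) * sin (tau * t))%:E).
  apply: (@integrable_le_expR_cosh _ _ 1 x) => //; first by measurability.
  move=> t; rewrite normrM ger0_norm ?expR_ge0// mulrC ler_pM//.
  exact: sin_max.
have S0 : \int[mu]_t (expR (- (x * cosh t)) * sin (tau * t))%:E = 0.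
  apply: integral_odd => // t.
  by rewrite coshN mulrN sinN -EFinN mulrN.
apply/esym; transitivity (\int[mu]_s ((2 * macdonald_im tau x)%:E *
    (expR (- (x * cosh s)) * cos (tau * s))%:E)).
  apply: eq_integral => s _ /=.
  transitivity (\int[mu]_t
   ((expR (- (x * cosh s)) * cos (tau * s))%:E *
      (expR (- (x * cosh t)) * cos (tau * t))%:E -
    (expR (- (x * cosh s)) * sin (tau * s))%:E *
      (expR (- (x * cosh t)) * sin (tau * t))%:E)).
    apply: eq_integral => t _; rewrite -!EFinM -EFinB; congr EFin.
    by rewrite /F /= expRD mulrDr cosD; ring.
  rewrite integralB//; [|exact: integrableZl|exact: integrableZl].
  rewrite integralZl// integralZl// S0 mule0 sube0 integral_macdonald//.
  by rewrite muleC.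
rewrite integralZl// integral_macdonald// -EFinM; congr EFin; ring.
Qed.

(** The rotation turns the sum of the two cosh into 2 cosh u cosh v, while the phase keeps only the
    variable u. *)
Lemma sqr_macdonald_rotation (tau x : R) : (0 < x)%R ->
  ((2 * macdonald_im tau x) ^+ 2)%:E = 2 * \int[mu \x mu]_z
    (expR (- (2 * x * cosh z.1 * cosh z.2)) * cos (2 * tau * z.1))%:E.
Proof.
move=> x0.
have key (u v : R) : (expR (- (x * cosh (u - v)) - x * cosh (u + v)) *
      cos (tau * (u - v + (u + v))) =
    expR (- (2 * x * cosh u * cosh v)) * cos (2 * tau * u))%R.
  rewrite -opprD -mulrDr cosh_addB; congr (expR _ * cos _)%R; ring.
rewrite sqr_macdonald// integral_rotation.
  congr (_ * _); apply: eq_integral => z _ /=; congr EFin.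
  exact: key.
apply: (integrable_prod_expR_cosh x0); first by measurability.
move=> z; rewrite normrM ger0_norm ?expR_ge0// -expRD -[leRHS]mulr1.
by rewrite ler_pM ?expR_ge0// cos_max.
Qed.

End product_formula.

(** * Estimates drawn from the product formula *)

Section macdonald_bounds.
Context {R : realType}.
Local Notation mu := (@lebesgue_measure R).
Local Open Scope ereal_scope.

(** Converts decay in the product of the cosh into decay in each variable, as the integrability
    criterion on the plane requires. *)
Let cosh_mul_ge (u v : R) : (cosh u + cosh v <= 2 * cosh u * cosh v)%R.
Proof. have := cosh_ge1 u; have := cosh_ge1 v; nra. Qed.

Let xcosh_gt0 (x v : R) : (0 < x -> 0 < 2 * x * cosh v)%R.
Proof. by move=> x0; rewrite mulr_gt0 ?cosh_gt0// mulr_gt0. Qed.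

Let exp_swap (tau x u v : R) :
  (expR (- (2 * x * cosh u * cosh v)) * cos (2 * tau * u) =
   expR (- (2 * x * cosh v * cosh u)) * cos (2 * tau * u))%R.
Proof. by congr (expR _ * _)%R; ring. Qed.

(** The parameters [d] and [k] let one statement serve twice: both are 0 for the rotated integrand,
    and they carry the damping and the extra phase after the contour shift. *)
Lemma integrable_shifted (c d k tau : R) : (0 < c)%R ->
  (mu \x mu).-integrable setT (fun z : R * R =>
    (expR (- d - 2 * c * cosh z.1 * cosh z.2) *
      cos (2 * tau * z.1 - k * sinh z.1 * cosh z.2))%:E).
Proof.
move=> c0.
pose f z : R := (expR (- d - 2 * c * cosh z.1 * cosh z.2) *
      cos (2 * tau * z.1 - k * sinh z.1 * cosh z.2))%R.
have mf : measurable_fun setT f by rewrite /f; measurability.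
pose g z : R := (expR (- (2 * c * cosh z.1 * cosh z.2)) *
      cos (2 * tau * z.1 - k * sinh z.1 * cosh z.2))%R.
have mg : measurable_fun setT g by rewrite /g; measurability.
have ig : (mu \x mu).-integrable setT (EFin \o g).
  apply: (integrable_prod_expR_cosh c0 mg) => -[u v] /=.
  rewrite /g normrM ger0_norm ?expR_ge0// -expRD -[leRHS]mulr1.
  rewrite ler_pM ?expR_ge0// ?cos_max// ler_expR.
  have := cosh_mul_ge u v; move/(ler_wpM2l (ltW c0)); rewrite /=; lra.
apply: (eq_integrable measurableT _ _ _ (integrableZl measurableT (expR (- d)) ig)).
by move=> z _; rewrite /= -EFinM; congr EFin; rewrite /g mulrA -expRD.
Qed.

Let integrable_rotated (tau x : R) : (0 < x)%R ->
  (mu \x mu).-integrable setT (fun z : R * R =>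
    (expR (- (2 * x * cosh z.1 * cosh z.2)) * cos (2 * tau * z.1))%:E).
Proof.
move=> x0; apply: (eq_integrable measurableT _ _ _ (integrable_shifted 0 0 tau x0)).
by move=> z _; congr EFin; rewrite oppr0 sub0r mul0r mul0r subr0.
Qed.

(** The product formula with absolute values: integrating over u first, the inner integral is 2 K_{2
    tau}(2 x cosh v). The function [h] will be the bound supplied by the induction hypothesis. *)
Lemma sqr_macdonald_le (tau x : R) (h : R -> R) : (0 < x)%R ->
  measurable_fun setT h ->
  (forall v, `|macdonald_im (2 * tau) (2 * x * cosh v)| <= h v)%R ->
  (macdonald_im tau x ^+ 2)%:E <= \int[mu]_v (h v)%:E.
Proof.
move=> x0 mh Kh.
have h0 v : (0 <= h v)%R by exact: le_trans (Kh v).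
(* The 4 on the left is matched by the Jacobian 2 of the rotation and the 2 from integrating u over
   the whole line. *)
suff : ((2 * macdonald_im tau x) ^+ 2)%:E <= 2%:E * (2%:E * \int[mu]_v (h v)%:E).
  rewrite muleA -EFinM exprMn (EFinM (2 ^+ 2)).
  by rewrite (expr2 (2 : R)) lee_pmul2l// lte_fin mulr_gt0.
rewrite sqr_macdonald_rotation// lee_pmul2l//.
have fi := integrable_rotated tau x0.
rewrite -(integral21_prod_meas1 fi) /fubini_G /=.
apply: (le_trans (lee_abs _)).
have mG := measurable_fubini_G fi.
apply: (le_trans (le_abse_integral mu measurableT mG)).
rewrite -ge0_integralZl//; 
  [|exact/measurable_EFinP|by move=> v _; rewrite lee_fin].
apply: ge0_le_integral => //.
- exact: measurableT_comp.
- by apply: emeasurable_funM => //; exact/measurable_EFinP.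
move=> v _; rewrite /fubini_G /=.
rewrite (_ : \int[mu]_u _ = (2 * macdonald_im (2 * tau) (2 * x * cosh v))%:E).
  by rewrite -EFinM lee_fin normrM ger0_norm// ler_pM2l.
rewrite -integral_macdonald; last exact: xcosh_gt0.
by apply: eq_integral => u _; congr EFin; exact: exp_swap.
Qed.

(** For each v the contour in u is moved to height theta; Fubini then puts the integral over v
    inside, where the oscillatory estimate applies. The order matters, since the shift is made in
    the u-integral. *)
Lemma sqr_macdonald_shift (tau x theta : R) : (0 <= tau)%R -> (0 < x)%R ->
  (0 <= theta < pi / 2)%R ->
  ((2 * macdonald_im tau x) ^+ 2)%:E = 2%:E * \int[mu]_u \int[mu]_v
    (expR (- (theta * (2 * tau)) - 2 * (x * cos theta) * cosh u * cosh v) *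
     cos (2 * tau * u - 2 * x * sin theta * sinh u * cosh v))%:E.
Proof.
move=> tau0 x0 tp.
have key (u v : R) :
    (expR (- (theta * (2 * tau)) - 2 * x * cosh v * cos theta * cosh u) *
      cos (2 * tau * u - 2 * x * cosh v * sin theta * sinh u) =
    expR (- (theta * (2 * tau)) - 2 * (x * cos theta) * cosh u * cosh v) *
     cos (2 * tau * u - 2 * x * sin theta * sinh u * cosh v))%R.
  by congr (expR _ * cos _)%R; ring.
have c0 : (0 < x * cos theta)%R.
  rewrite mulr_gt0// cos_gt0_pihalf//; case/andP: tp => t0 ->.
  by rewrite andbT (lt_le_trans _ t0)// oppr_lt0 divr_gt0// pi_gt0.
rewrite sqr_macdonald_rotation//; congr (_ * _).
have fi := integrable_rotated tau x0.
have gi := integrable_shifted (theta * (2 * tau)) (2 * x * sin theta) tau c0.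
rewrite -(integral21_prod_meas1 fi) /fubini_G /=.
transitivity (\int[mu]_v \int[mu]_u
    (expR (- (theta * (2 * tau)) - 2 * (x * cos theta) * cosh u * cosh v) *
     cos (2 * tau * u - 2 * x * sin theta * sinh u * cosh v))%:E).
  apply: eq_integral => v _.
  have xv0 : (0 < 2 * x * cosh v)%R by exact: xcosh_gt0.
  have t20 : (0 <= 2 * tau)%R by rewrite mulr_ge0.
  have E := integral_shift t20 xv0 tp.
  have i1 := integrable_macdonald (2 * tau) xv0.
  transitivity (\int[mu]_t (expR (- (2 * x * cosh v * cosh t)) * cos (2 * tau * t))%:E).
    by apply: eq_integral => u _; congr EFin; exact: exp_swap.
  rewrite -[LHS]fineK; last exact: (integrable_fin_num measurableT i1).
  rewrite /Rintegral in E; rewrite -E fineK.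
    by apply: eq_integral => u _; congr EFin; exact: key.
  apply: integrable_fin_num => //.
  apply: (@integrable_le_expR_cosh _ _ (expR (- (theta * (2 * tau))))
    (2 * x * cosh v * cos theta)).
  - by rewrite mulr_gt0// -(pmulr_rgt0 _ x0).
  - by measurability.
  - move=> t; rewrite normrM ger0_norm ?expR_ge0// -expRD -[leRHS]mulr1.
    by rewrite ler_pM ?expR_ge0// cos_max.
exact/esym/(Fubini gi).
Qed.

End macdonald_bounds.

(** * Gamma function and the integrals of powers of cosh and sinh *)

Section substitution_halfline.
Context {R : realType}.
Local Notation mu := (@lebesgue_measure R).
Variables (F dF G : R -> R).
Hypothesis is_derive_F : forall u : R, 0 < u -> is_derive u 1 F (dF u).
Hypothesis dF_gt0 : forall u : R, 0 < u -> 0 < dF u.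
Hypothesis continuous_dF : forall u : R, 0 < u -> {for u, continuous dF}.
Hypothesis cvg_dF : cvg (dF u @[u --> +oo]).
Hypothesis cvg_Fy : F u @[u --> +oo] --> +oo.
Hypothesis cvg_F0 : F u @[u --> 0^'+] --> -oo.
Hypothesis continuous_G : continuous G.
Hypothesis G_ge0 : forall y, 0 <= G y.

Let F_incr (u v : R) : 0 < u -> u < v -> F u < F v.
Proof.
move=> u0 uv; have h (z : R) : z \in `]u, v[ -> is_derive z 1 F (dF z).
  by rewrite in_itv/= => /andP[uz _]; apply: is_derive_F; exact: lt_trans uz.
have cF : {within `[u, v], continuous F}.
  apply: derivable_within_continuous => z; rewrite in_itv/= => /andP[uz _].
  by have [] := is_derive_F (lt_le_trans u0 uz).
have [z zI] := MVT uv h cF; move: zI; rewrite in_itv/= => /andP[uz _] E.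
by rewrite -subr_gt0 E mulr_gt0 ?subr_gt0// dF_gt0// (lt_trans u0).
Qed.

Let derive1_F (u : R) : 0 < u -> F^`()%classic u = dF u.
Proof. by move=> u0; rewrite derive1E (@derive_val _ _ _ _ _ _ _ (is_derive_F u0)). Qed.

Let near_derive1_F (u : R) : 0 < u -> \forall v \near u, dF v = F^`()%classic v.
Proof.
move=> u0; near=> v; rewrite derive1_F//; near: v; exact: lt_nbhsr.
Unshelve. all: end_near. Qed.

Let continuous_derive1_F (u : R) : 0 < u -> {for u, continuous F^`()%classic}.
Proof.
move=> u0; rewrite /prop_for /continuous_at (derive1_F u0).
apply: cvg_trans; last exact: (continuous_dF u0).
by apply: near_eq_cvg; exact: near_derive1_F.
Qed.

Let integral_subst_ray (a : R) : 0 < a ->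
  (\int[mu]_(y in `[F a, +oo[) (G y)%:E =
   \int[mu]_(u in `[a, +oo[) (G (F u) * dF u)%:E)%E.
Proof.
move=> a0; rewrite (@increasing_ge0_integration_by_substitutiony _ F G a).
- apply: eq_integral => u; rewrite inE/= in_itv/= andbT => au.
  by rewrite !fctE derive1_F// (lt_le_trans a0).
- move=> u v; rewrite !in_itv/= !andbT => au av uv.
  by apply: F_incr => //; exact: lt_le_trans au.
- move=> u; rewrite in_itv/= andbT => au.
  by apply: continuous_derive1_F; exact: lt_trans au.
- apply/cvg_ex; exists (F^`()%classic a); apply: cvg_at_right_filter.
  exact: continuous_derive1_F.
- have [l dFl] := (cvg_ex _).1 cvg_dF.
  apply/cvg_ex; exists l; apply: cvg_trans; last exact: dFl.
  apply: near_eq_cvg; apply: filterS (nbhs_pinfty_gt (num_real (0 : R))) => v v0.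
  by rewrite derive1_F.
- split.
    move=> u; rewrite in_itv/= andbT => au.
    by have [] := is_derive_F (lt_trans a0 au).
  apply: cvg_at_right_filter; apply/differentiable_continuous/derivable1_diffP.
  by have [] := is_derive_F a0.
- exact: cvg_Fy.
- exact: continuous_subspaceT.
- by move=> y _; exact: G_ge0.
Qed.

Let a_ (n : nat) : R := n.+1%:R^-1.

Let a_gt0 n : 0 < a_ n. Proof. by rewrite invr_gt0 ltr0n. Qed.

Let a_decr m n : (m <= n)%N -> a_ n <= a_ m.
Proof. by move=> mn; rewrite lef_pV2 ?posrE ?ltr0n// ler_nat ltnS. Qed.

Let F_a_decr m n : (m <= n)%N -> F (a_ n) <= F (a_ m).
Proof.
move=> /a_decr; rewrite le_eqVlt => /predU1P[->//|h].
by apply/ltW/F_incr.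
Qed.

(** [F] is singular at 0, so the substitution is made on the rays starting at [a_ n] and [F (a_ n)].
    These increase to the open half-line and to the line, and monotone convergence concludes. *)
Lemma ge0_integral_subst_halfline :
  (\int[mu]_y (G y)%:E = \int[mu]_(u in `]0%R, +oo[) (G (F u) * dF u)%:E)%E.
Proof.
have mG : measurable_fun setT G by exact: continuous_measurable_fun.
have E1 : \bigcup_n `[F (a_ n), +oo[%classic = [set: R].
  apply/seteqP; split => // y _.
  move/cvgrNyPle : cvg_F0 => /(_ y) [e /= e0 he].
  have [n _ hn] := near_infty_natSinv_lt (PosNum e0).
  exists n => //=; rewrite in_itv/= andbT; apply: he => /=.
    by rewrite sub0r normrN gtr0_norm//; apply: hn => /=.
  exact: a_gt0.
have E2 : \bigcup_n `[a_ n, +oo[%classic = `]0%R, +oo[%classic.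
  apply/seteqP; split => [y [n _ /=]|y /=]; rewrite !in_itv/= !andbT.
    by apply: lt_le_trans; exact: a_gt0.
  move=> y0; have [n _ hn] := near_infty_natSinv_lt (PosNum y0).
  by exists n => //=; rewrite in_itv/= andbT ltW//; apply: hn => /=.
have nd1 : nondecreasing_seq (fun n => `[F (a_ n), +oo[%classic).
  move=> m n mn; rewrite subsetEset => y /=; rewrite !in_itv/= !andbT.
  apply: le_trans; exact: F_a_decr.
have nd2 : nondecreasing_seq (fun n => `[a_ n, +oo[%classic).
  move=> m n mn; rewrite subsetEset => y /=; rewrite !in_itv/= !andbT.
  by apply: le_trans; exact: a_decr.
have m2 : measurable_fun (`]0%R, +oo[%classic : set R) (fun u : R => G (F u) * dF u).
  apply: open_continuous_measurable_fun; first exact: interval_open.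
  move=> u; rewrite inE/= in_itv/= andbT => u0.
  apply: continuousM; last exact: continuous_dF.
  apply: continuous_comp; last exact: continuous_G.
  apply/differentiable_continuous/derivable1_diffP.
  by have [] := is_derive_F u0.
have c1 : (\int[mu]_(y in `[F (a_ n), +oo[) (G y)%:E @[n --> \oo] -->
    \int[mu]_(y in \bigcup_n `[F (a_ n), +oo[%classic) (G y)%:E)%E.
  apply: ge0_nondecreasing_set_cvg_integral => //.
  - by move=> n; apply/measurable_EFinP; exact: measurable_funTS.
  - by move=> n y _; rewrite lee_fin.
have c2 : (\int[mu]_(u in `[a_ n, +oo[) (G (F u) * dF u)%:E @[n --> \oo] -->
    \int[mu]_(u in \bigcup_n `[a_ n, +oo[%classic) (G (F u) * dF u)%:E)%E.
  apply: ge0_nondecreasing_set_cvg_integral => //.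
  - move=> n; apply/measurable_EFinP; apply: measurable_funS m2 => //.
    move=> y /=; rewrite !in_itv/= !andbT; apply: lt_le_trans; exact: a_gt0.
  - move=> n u /=; rewrite in_itv/= andbT lee_fin => au.
    by rewrite mulr_ge0// ltW// dF_gt0// (lt_le_trans _ au).
move: c1 c2; rewrite E1 E2 => c1 c2.
apply: (cvg_unique _ c1) => //; apply: cvg_trans c2; apply: near_eq_cvg.
by apply: nearW => n; rewrite integral_subst_ray.
Qed.

End substitution_halfline.

(** * Euler's integral in logarithmic variables *)

Section gamma.
Context {R : realType}.
Local Notation mu := (@lebesgue_measure R).

(** Gamma after the substitution t = e^y, kept in the extended reals so that Tonelli applies before
    finiteness is known. *)
Let Gamma_log (s : R) := (\int[mu]_y (expR (s * y - expR y))%:E)%E.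
Let cosh_int (a : R) := (\int[mu]_v ((2 * cosh v) `^ (- a))%:E)%E.

Lemma cvg_ln_pinfty : @ln R u @[u --> +oo] --> +oo.
Proof.
apply/cvgryPge => A; near=> u.
have eu : expR A <= u by near: u; apply: nbhs_pinfty_ge; exact: num_real.
by rewrite -(expRK A) ler_ln// posrE ?expR_gt0// (lt_le_trans _ eu) ?expR_gt0.
Unshelve. all: end_near. Qed.

Lemma continuous_powR_comp (f : R -> R) (p : R) : continuous f ->
  (forall t, 0 < f t) -> continuous (fun t => f t `^ p).
Proof.
move=> cf f0 t; apply: (@continuous_comp _ _ _ f (fun a => a `^ p)); first exact: cf.
apply/differentiable_continuous/derivable1_diffP.
by have [] := is_derive1_powR p (f0 t).
Qed.

(** The substitution is y = ln t; dy = dt / t accounts for the change of exponent from s - 1 to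
    s. *)
Lemma integral_Gamma_log (s : R) :
  (\int[mu]_(t in `]0%R, +oo[) (t `^ (s - 1) * expR (- t))%:E =
   \int[mu]_y (expR (s * y - expR y))%:E)%E.
Proof.
rewrite (@ge0_integral_subst_halfline _ (@ln R) (fun u => u^-1)).
- apply: eq_integral => t; rewrite inE/= in_itv/= andbT => t0.
  congr EFin; rewrite lnK ?posrE// /powR gt_eqF//.
  rewrite mulrBl mul1r expRB lnK ?posrE// expRB expRN; field.
  by rewrite !gt_eqF ?expR_gt0.
- by move=> u u0; rewrite invr_gt0.
- move=> u u0; apply/differentiable_continuous/derivable1_diffP.
  by apply: derivableV; rewrite ?gt_eqF.
- apply/cvg_ex; exists 0; apply/cvgrPdist_le => e e0; near=> u.
  have eu : e^-1 <= u by near: u; apply: nbhs_pinfty_ge; exact: num_real.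
  have u0 : 0 < u by rewrite (lt_le_trans _ eu)// invr_gt0.
  by rewrite sub0r normrN gtr0_norm ?invr_gt0// invf_ple ?posrE.
- exact: cvg_ln_pinfty.
- exact: lnNy.
- move=> y; apply/differentiable_continuous/derivable1_diffP.
  by eapply ex_derive; derive.
- by move=> y; exact: expR_ge0.
Unshelve. all: end_near. Qed.

Let GammaE (s : R) : Gamma s = fine (Gamma_log s).
Proof. by rewrite /Gamma /Rintegral integral_Gamma_log. Qed.

(** For y <= 0 the factor e^(-e^y) is at most 1. For y > 0 the claim is e^(2 s y) <= 4 e^(e^y),
    which s <= 1 reduces to the case s = 1. *)
Let integrable_Gamma_log (s : R) : 0 < s -> s <= 1 ->
  mu.-integrable setT (fun y => (expR (s * y - expR y))%:E).
Proof.
move=> s0 s1; apply: (@integrable_le_expR_abs _ _ 4 s) => //.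
  by measurability.
move=> y; rewrite ger0_norm ?expR_ge0//.
have [y0|y0] := leP y 0.
  rewrite ler0_norm// mulrN opprK -[leLHS]mul1r ler_pM ?expR_ge0//; first by lra.
  by rewrite ler_expR lerBlDr lerDl expR_ge0.
rewrite gtr0_norm//.
(* Square e^y / 2 <= e^(e^y / 2), a consequence of 1 + z <= e^z. *)
have e4 : expR y ^+ 2 <= 4 * expR (expR y).
  have h := expR_ge1Dx (expR y / 2); have p := expR_gt0 y.
  have -> : expR (expR y) = expR (expR y / 2) ^+ 2.
    by rewrite -expRM_natl; congr expR; field.
  move: h p; move: (expR (expR y / 2)) (expR y) => A B h p.
  nra.
have e2 : expR (s * y) * expR (s * y) <= expR y ^+ 2.
  have sy : s * y <= y by rewrite -[leRHS]mul1r ler_wpM2r// ltW.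
  by rewrite expr2 -!expRD ler_expR; lra.
rewrite expRB ler_pdivrMr ?expR_gt0// expRN.
rewrite -(@ler_pM2r _ (expR (s * y))) ?expR_gt0//.
apply: (le_trans e2); apply: (le_trans e4).
rewrite le_eqVlt; apply/orP; left; apply/eqP.
by field; rewrite gt_eqF ?expR_gt0.
Qed.

Let Gamma_logE (s : R) : 0 < s -> s <= 1 -> Gamma_log s = (Gamma s)%:E.
Proof.
move=> s0 s1; rewrite GammaE fineK//.
exact: (integrable_fin_num measurableT (integrable_Gamma_log s0 s1)).
Qed.

Lemma Gamma_gt0 (s : R) : 0 < s -> s <= 1 -> 0 < Gamma s.
Proof.
move=> s0 s1; rewrite -lte_fin -Gamma_logE//.
(* On [0, 1] the logarithmic integrand is at least e^(-e). *)
apply: (@lt_le_trans _ _ (\int[mu]_(y in `[0%R, 1%R]) (expR (- expR 1))%:E)%E).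
  rewrite integral_cst//= lebesgue_measure_itv/= lte_fin ltr01 sube0 mule1.
  by rewrite lte_fin expR_gt0.
apply: (@le_trans _ _ (\int[mu]_(y in `[0%R, 1%R]) (expR (s * y - expR y))%:E)%E).
  apply: ge0_le_integral => //.
  - by apply/measurable_EFinP/measurable_funTS; measurability.
  - move=> y /=; rewrite in_itv/= => /andP[y0 y1].
    rewrite lee_fin ler_expR; have : expR y <= expR 1 by rewrite ler_expR.
    have : 0 <= s * y by rewrite mulr_ge0// ltW.
    lra.
apply: ge0_subset_integral => //.
by apply/measurable_EFinP; measurability.
Qed.

(* With p = e^(u-v), q = e^(u+v) the double integral Gamma(s)^2 over p, q > 0
   separates after the shift w = u + ln (2 cosh v). *)
Let sqr_Gamma_log (s : R) :
  (Gamma_log s * Gamma_log s = 2%:E * (Gamma_log (2 * s) * cosh_int (2 * s)))%E.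
Proof.
pose g (y : R) := expR (s * y - expR y).
pose H (z : R * R) := (g z.1 * g z.2)%:E.
have mg : measurable_fun setT g by rewrite /g; measurability.
have mH : measurable_fun setT H.
  by apply/measurable_EFinP; rewrite /g; measurability.
have g0 y : 0 <= g y by exact: expR_ge0.
have H0 z : (0 <= H z)%E by rewrite lee_fin mulr_ge0.
have Gl0 r : (0 <= Gamma_log r)%E.
  by apply: integral_ge0 => y _; rewrite lee_fin expR_ge0.
transitivity (\int[mu \x mu]_z H z)%E.
  rewrite (fubini_tonelli1 (m1 := mu) (m2 := mu) H)// /fubini_F.
  rewrite -ge0_integralZr//; [|by apply/measurable_EFinP].
  apply: eq_integral => u _; rewrite -ge0_integralZl//.
  by apply/measurable_EFinP.
rewrite (ge0_integral_rotation mH H0); congr (_ * _)%E.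
pose K (z : R * R) := (expR (2 * s * z.1 - expR z.1 * (2 * cosh z.2)))%:E.
have mK : measurable_fun setT K by apply/measurable_EFinP; measurability.
have K0 z : (0 <= K z)%E by rewrite lee_fin expR_ge0.
have HK (u v : R) : H (u - v, u + v) = K (u, v).
  congr EFin; rewrite /g /= -expRD; congr expR.
  by rewrite /cosh !expRD; field.
transitivity (\int[mu \x mu]_z K z)%E.
  by apply: eq_integral => z _; rewrite HK; case: z.
rewrite (fubini_tonelli2 (m1 := mu) (m2 := mu) K)// /fubini_G.
rewrite -ge0_integralZl//; first last.
- by move=> v _; rewrite lee_fin powR_ge0.
- by apply/measurable_EFinP; measurability.
apply: eq_integral => v _.
have c0 : 0 < 2 * cosh v by rewrite mulr_gt0// cosh_gt0.
have key (w : R) : expR (2 * s * (w - ln (2 * cosh v)) -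
      expR (w - ln (2 * cosh v)) * (2 * cosh v)) =
    expR (2 * s * w - expR w) * (2 * cosh v) `^ (- (2 * s)).
  rewrite /powR gt_eqF// -expRD; congr expR.
  rewrite (expRD w) expRN lnK ?posrE//.
  by field; rewrite gt_eqF// cosh_gt0.
rewrite (@ge0_integral_affine _ 1 (- ln (2 * cosh v)) (fun u => K (u, v)))//.
  rewrite mul1e -ge0_integralZr//; first last.
  - by rewrite lee_fin powR_ge0.
  - by apply/measurable_EFinP; measurability.
  apply: eq_integral => w _; rewrite -EFinM; congr EFin.
  by rewrite mul1r; exact: key.
exact: (measurableT_comp mK).
Qed.

Let Gamma_log1 : Gamma_log 1 = 1%E.
Proof.
rewrite /Gamma_log -integral_Gamma_log subrr.
rewrite integral_itv_obnd_cbnd; last first.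
  apply/measurable_EFinP/measurable_funTS.
  by under eq_fun do rewrite powRr0; measurability.
transitivity (\int[mu]_(t in `[0%R, +oo[) (expR (- (1 * t)))%:E)%E.
  by apply: eq_integral => t _; rewrite powRr0 !mul1r.
by rewrite integral_expR_0y// invr1.
Qed.

Lemma integral_cosh_powR (a : R) : 0 < a -> a <= 1 ->
  (\int[mu]_v ((2 * cosh v) `^ (- a))%:E =
   (Gamma (a / 2) ^+ 2 / (2 * Gamma a))%:E)%E.
Proof.
move=> a0 a1.
have G0 := Gamma_gt0 a0 a1.
have := sqr_Gamma_log (a / 2); rewrite (_ : 2 * (a / 2) = a); last by field.
rewrite !Gamma_logE//; [|lra|lra].
rewrite -/(cosh_int a).
(* Nonnegativity excludes the value -oo; the value +oo is excluded because the left side of the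
   identity is finite and Gamma a > 0. *)
have : (0 <= cosh_int a)%E.
  by apply: integral_ge0 => v _; rewrite lee_fin powR_ge0.
case: (cosh_int a) => [b| |]//=.
  move=> _; rewrite -!EFinM => -[E]; congr EFin.
  by rewrite expr2 E; field; rewrite gt_eqF.
by rewrite gt0_muley ?lte_fin// gt0_muley ?lte_fin// -EFinM.
Qed.

Lemma sqr_Gamma_half_ge2 : 2 <= Gamma (2^-1 : R) ^+ 2.
Proof.
have := sqr_Gamma_log 2^-1; rewrite divff// Gamma_log1 mul1e.
rewrite Gamma_logE//; [|lra] => E.
have : (1 <= cosh_int 1)%E.
  rewrite (_ : 1%E = (2^-1)%:E * (2 / 1)%:E)%E; last first.
    by rewrite -EFinM; congr EFin; field.
  rewrite -integral_expR_abs// -ge0_integralZl//; first last.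
  - by apply/measurable_EFinP; measurability.
  apply: ge0_le_integral => //.
  - by apply/measurable_EFinP; measurability.
  - by apply/measurable_EFinP; measurability.
  move=> v _; have c0 : 0 < 2 * cosh v by rewrite mulr_gt0// cosh_gt0.
  have e0 : 0 < 2 * expR `|v| by rewrite mulr_gt0// expR_gt0.
  rewrite -EFinM lee_fin powR_inv1 ?(ltW c0)// mul1r expRN -invfM.
  by rewrite lef_pV2 ?posrE// ler_pM2l// cosh_le_expR.
move=> h; rewrite expr2 -lee_fin EFinM E -[X in (X <= _)%E]mule1.
by rewrite lee_pmul2l.
Qed.

End gamma.

(** * The integral of sinh^(-1/2) over the half-line *)

Section base_case.
Context {R : realType}.
Local Notation mu := (@lebesgue_measure R).

(* With sinh u = e^y, so that 2 cosh y = cosh(u)^2 / sinh(u). *)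
Lemma integral_sinh_powR :
  (\int[mu]_(u in `[0%R, +oo[) (sinh u `^ (- 2^-1))%:E =
   \int[mu]_y ((2 * cosh y) `^ (- 2^-1))%:E)%E.
Proof.
have msinh : measurable_fun setT (fun u : R => (sinh u `^ (- 2^-1))%:E).
  by apply/measurable_EFinP; measurability.
rewrite -integral_itv_obnd_cbnd; last exact: measurable_funTS msinh.
have dlns (u : R) : 0 < u ->
    is_derive u 1 (fun u => ln (sinh u)) (cosh u * (sinh u)^-1).
  move=> u0; have s0 : 0 < sinh u by exact: sinh_gt0.
  have d1 := is_derive_sinh_comp (is_derive_var u).
  have d2 := is_derive1_comp (is_derive1_ln s0) d1.
  by apply: (is_derive_eq d2); rewrite mul1r mulrC.
have sinh_small (A : R) : \forall u \near 0^'+, sinh u <= expR A.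
  apply: (@cvgr_le _ _ _ _ _ 0); last exact: expR_gt0.
  by rewrite -[X in _ --> X]sinh0; apply: cvg_at_right_filter; exact: continuous_sinh.
apply/esym; rewrite (@ge0_integral_subst_halfline _ (fun u => ln (sinh u))
  (fun u => cosh u * (sinh u)^-1) (fun y => (2 * cosh y) `^ (- 2^-1)) dlns).
- apply: eq_integral => u; rewrite inE/= in_itv/= andbT => u0; congr EFin.
  have s0 : 0 < sinh u by exact: sinh_gt0.
  have c0 : 0 < cosh u by exact: cosh_gt0.
  have -> : 2 * cosh (ln (sinh u)) = cosh u ^+ 2 * (sinh u)^-1.
    have h := cosh2_sinh2 u.
    have -> : cosh (ln (sinh u)) = (sinh u + (sinh u)^-1) / 2.
      by rewrite {1}/cosh expRN lnK.
    have -> : cosh u ^+ 2 = 1 + sinh u ^+ 2 by rewrite -h subrK.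
    by field; rewrite gt_eqF.
  rewrite powRM ?invr_ge0 ?sqr_ge0 ?(ltW s0)//.
  rewrite -powR_mulrn ?(ltW c0)// -powRrM.
  have -> : 2%:R * - 2^-1 = - 1 :> R by field.
  rewrite powR_inv1 ?(ltW c0)//.
  rewrite -{1}(powR_inv1 (ltW s0)) -powRrM.
  rewrite mulrAC mulrA (mulVf (lt0r_neq0 c0)) mul1r.
  rewrite -{1}(powR_inv1 (ltW s0)) -powRD; last by rewrite (gt_eqF s0) implybT.
  by congr (_ `^ _); field.
- by move=> u u0; rewrite divr_gt0// ?cosh_gt0// sinh_gt0.
- move=> u u0; apply: continuousM; first exact: continuous_cosh.
  apply: continuousV; first by rewrite gt_eqF// sinh_gt0.
  exact: continuous_sinh.
(* The derivative is coth u, squeezed between 1 and 1 + e^(-u) as soon as sinh u >= 1. *)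
- apply/cvg_ex; exists 1.
  apply: (@squeeze_cvgr _ _ _ _ (cst 1) (fun u => 1 + expR (- u))).
  + near=> u.
    have u1 : 1 <= u by near: u; apply: nbhs_pinfty_ge; exact: num_real.
    have s1 : 1 <= sinh u by rewrite (le_trans u1)// sinh_ge// (le_trans ler01).
    have s0 : 0 < sinh u by exact: lt_le_trans s1.
    have E : cosh u = sinh u + expR (- u) by rewrite /cosh /sinh; lra.
    rewrite E mulrDl divff ?gt_eqF// lerDl lerD2l.
    rewrite divr_ge0 ?expR_ge0 ?(ltW s0)//=.
    by rewrite ler_pdivrMr// -[leLHS]mulr1 ler_wpM2l ?expR_ge0.
  + exact: cvg_cst.
  + rewrite -[X in _ --> X](addr0 1); apply: cvgD; first exact: cvg_cst.
    exact: cvgr_expR.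
- apply/cvgryPge => A; near=> u.
  have u1 : expR A <= u by near: u; apply: nbhs_pinfty_ge; exact: num_real.
  have u0 : 0 < u by rewrite (lt_le_trans _ u1)// expR_gt0.
  rewrite -(expRK A) ler_ln ?posrE ?expR_gt0 ?sinh_gt0//.
  by rewrite (le_trans u1)// sinh_ge// ltW.
- apply/cvgrNyPle => A; near=> u.
  have u0 : 0 < u by near: u; exact: nbhs_right_gt.
  rewrite -(expRK A) ler_ln ?posrE ?expR_gt0 ?sinh_gt0//.
  by near: u; exact: sinh_small.
- apply: continuous_powR_comp; last by move=> y; rewrite mulr_gt0// cosh_gt0.
  move=> y; apply/differentiable_continuous/derivable1_diffP.
  by eapply ex_derive; derive.
- by move=> y; exact: powR_ge0.
Unshelve. all: end_near. Qed.
End base_case.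

(** * The case n = 1 and the induction *)

Section exponential_decay.
Context {R : realType}.
Local Notation mu := (@lebesgue_measure R).

Lemma powRNhalf (a : R) : 0 <= a -> a `^ (- 2^-1) = (Num.sqrt a)^-1.
Proof. by move=> a0; rewrite powRN powR12_sqrt. Qed.

(** For fixed u the oscillatory estimate is applied with a = 2 x cos theta cosh u and b = 2 x sin
    theta sinh u. It does not depend on [a], so nothing degenerates when cos theta tends to 0. *)
Lemma sqr_macdonald_shift_le (tau x theta : R) : 0 <= tau -> 0 < x ->
  0 < theta < pi / 2 ->
  ((macdonald_im tau x ^+ 2)%:E <=
   (4 * expR (- (theta * (2 * tau))) * (2 * x * sin theta) `^ (- 2^-1))%:E *
   \int[mu]_y ((2 * cosh y) `^ (- 2^-1))%:E)%E.
Proof.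
move=> tau0 x0 /andP[t0 tp].
have pi0 := pi_gt0 R.
have c0 : 0 < x * cos theta.
  by rewrite mulr_gt0// cos_gt0_pihalf// tp andbT (lt_trans _ t0)// oppr_lt0 divr_gt0.
have s0 : 0 < 2 * x * sin theta.
  by rewrite !mulr_gt0// sin_gt0_pihalf// t0.
set e := expR (- (theta * (2 * tau))).
set k := (2 * x * sin theta) `^ (- 2^-1).
pose f (u v : R) :=
  expR (- (theta * (2 * tau)) - 2 * (x * cos theta) * cosh u * cosh v) *
    cos (2 * tau * u - 2 * x * sin theta * sinh u * cosh v).
have gi := integrable_shifted (theta * (2 * tau)) (2 * x * sin theta) tau c0.
have inner (u : R) : u != 0 ->
    (`|\int[mu]_v (f u v)%:E| <= (e * (4 * (k * `|sinh u| `^ (- 2^-1))))%:E)%E.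
  move=> u0.
  have a0 : 0 < 2 * (x * cos theta) * cosh u by rewrite mulr_gt0 ?cosh_gt0// mulr_gt0.
  have sh0 : sinh u != 0.
    have [uneg|upos|uE] := ltgtP u 0; last by rewrite uE eqxx in u0.
      by rewrite -(opprK u) sinhN oppr_eq0 gt_eqF// sinh_gt0 ?oppr_gt0.
    by rewrite gt_eqF// sinh_gt0.
  have b0 : 2 * x * sin theta * sinh u != 0 by rewrite mulf_neq0// gt_eqF.
  have h := abs_integral_oscillatory_le (2 * tau * u) a0 b0.
  set q := (fun v : R => expR (- (2 * (x * cos theta) * cosh u * cosh v)) *
    cos (2 * tau * u - 2 * x * sin theta * sinh u * cosh v)) in h.
  have iq : mu.-integrable setT (EFin \o q).
    apply: (@integrable_le_expR_cosh _ _ 1 _ a0); first by rewrite /q; measurability.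
    move=> v; rewrite /q normrM ger0_norm ?expR_ge0// mulrC ler_pM//.
    exact: cos_max.
  have -> : (\int[mu]_v (f u v)%:E = e%:E * \int[mu]_v (q v)%:E)%E.
    rewrite -integralZl//; apply: eq_integral => v _.
    by rewrite -EFinM; congr EFin; rewrite /f expRD -mulrA.
  rewrite abseM gee0_abs ?lee_fin ?expR_ge0// EFinM lee_pmul2l ?lte_fin ?expR_gt0//.
  rewrite -EFin_normr_Rintegral// lee_fin (le_trans h)//.
  by rewrite -powRNhalf// normrM (gtr0_norm s0) powRM ?normr_ge0// (ltW s0).
have mh : measurable_fun setT (fun u : R =>
    (e * (4 * (k * `|sinh u| `^ (- 2^-1))))%:E).
  by apply/measurable_EFinP; measurability.
have h0 (u : R) : (0 <= (e * (4 * (k * `|sinh u| `^ (- 2^-1))))%:E)%E.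
  by rewrite lee_fin !mulr_ge0 ?expR_ge0 ?powR_ge0.
have outer : (\int[mu]_u `|\int[mu]_v (f u v)%:E| <=
    \int[mu]_u (e * (4 * (k * `|sinh u| `^ (- 2^-1))))%:E)%E.
  apply: ae_ge0_le_integral => //.
  - apply: measurableT_comp => //; exact: (measurable_fubini_F gi).
  (* At u = 0 there is no oscillation, and the majorant is 0 there by the convention of [powR]; the
     comparison holds off this null set. *)
  - exists [set 0]; split; [exact: measurable_set1|exact: lebesgue_measure_set1|].
    move=> u /= hu; apply: contrapT => /eqP u0; apply: hu => _.
    exact: inner.
have ev : (\int[mu]_u (e * (4 * (k * `|sinh u| `^ (- 2^-1))))%:E =
    2%:E * ((e * (4 * k))%:E * \int[mu]_y ((2 * cosh y) `^ (- 2^-1))%:E))%E.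
  rewrite (ge0_integral_even mh); first last.
  - by move=> u; rewrite sinhN normrN.
  - exact: h0.
  congr (_ * _)%E; rewrite -integral_sinh_powR -ge0_integralZl//; first last.
  - by rewrite lee_fin !mulr_ge0 ?expR_ge0 ?powR_ge0.
  - by move=> u _; rewrite lee_fin powR_ge0.
  - by apply/measurable_EFinP/measurable_funTS; measurability.
  apply: eq_integral => u; rewrite inE/= in_itv/= andbT => u0.
  by rewrite ger0_norm ?sinh_ge0// -EFinM; congr EFin; rewrite !mulrA.
suff : (((2 * macdonald_im tau x) ^+ 2)%:E <=
   4%:E * ((4 * e * k)%:E * \int[mu]_y ((2 * cosh y) `^ (- 2^-1))%:E))%E.
  rewrite exprMn EFinM (_ : 2 ^+ 2 = 4 :> R); last by ring.
  by rewrite lee_pmul2l ?lte_fin.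
rewrite (@sqr_macdonald_shift _ tau x theta)//; last by rewrite ltW.
rewrite (_ : 4%:E * _ = 2%:E * \int[mu]_u (e * (4 * (k * `|sinh u| `^ (- 2^-1))))%:E)%E.
  rewrite lee_pmul2l//; apply: (le_trans (lee_abs _)); apply: le_trans outer.
  apply: le_abse_integral => //; exact: (measurable_fubini_F gi).
by rewrite ev !muleA -!EFinM; congr (_%:E * _)%E; ring.
Qed.

(* The limit theta -> pi/2 of the shifted bound. *)
Lemma sqr_macdonald_expR_le (tau x : R) : 0 <= tau -> 0 < x ->
  macdonald_im tau x ^+ 2 <=
   Gamma (2^-1 / 2) ^+ 2 * (x `^ (- 2^-1) * expR (- (pi * tau))).
Proof.
move=> tau0 x0.
have pi0 := pi_gt0 R.
have G0 : 0 < Gamma (2^-1 : R) by apply: Gamma_gt0 => //; lra.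
set B := Gamma (2^-1 / 2) ^+ 2 / (2 * Gamma (2^-1 : R)).
have B0 : 0 <= B by rewrite divr_ge0 ?sqr_ge0// mulr_ge0// ltW.
pose h (theta : R) := 4 * expR (- (theta * (2 * tau))) *
  (2 * x * sin theta) `^ (- 2^-1) * B.
have hle : \forall theta \near (pi / 2)^'-, macdonald_im tau x ^+ 2 <= h theta.
  near=> theta.
  have tI : 0 < theta < pi / 2.
    apply/andP; split; near: theta; last exact: nbhs_left_lt.
    by apply: nbhs_left_gt; rewrite divr_gt0.
  have := sqr_macdonald_shift_le tau0 x0 tI.
  by rewrite integral_cosh_powR; [rewrite -EFinM lee_fin|lra|lra].
(* At theta = pi/2 the sine is 1, so the base of the power stays positive and [h] is continuous
   there. *)
have ch : h theta @[theta --> (pi / 2)^'-] --> h (pi / 2).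
  apply: cvg_at_left_filter; apply/differentiable_continuous/derivable1_diffP.
  have sp : 0 < 2 * x * sin (pi / 2) by rewrite sin_pihalf mulr1 mulr_gt0.
  have [d1v d1] : exists d, is_derive (pi / 2 : R) (1 : R)
      (fun theta : R => 2 * x * sin theta) d by eexists; derive.
  have d2 : derivable (fun theta : R => (2 * x * sin theta) `^ (- 2^-1)) (pi / 2) 1.
    by have [] := @is_derive1_comp R (fun a => a `^ (- 2^-1))
      (fun theta => 2 * x * sin theta) _ _ _ (is_derive1_powR (- 2^-1) sp) d1.
  have d3 : derivable (fun theta : R => 4 * expR (- (theta * (2 * tau)))) (pi / 2) 1.
    by eapply ex_derive; derive.
  rewrite /h; apply: derivableM; last exact: derivable_cst.
  exact: derivableM.
have h1 : macdonald_im tau x ^+ 2 <= h (pi / 2).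
  by rewrite -(cvg_lim _ ch)//; exact: (limr_ge (cvgP _ ch) hle).
apply: (le_trans h1).
rewrite /h sin_pihalf mulr1 powRM ?(ltW x0)//.
have -> : expR (- (pi / 2 * (2 * tau))) = expR (- (pi * tau)).
  by congr expR; field.
(* The excess over the claimed bound is the factor sqrt 2 / Gamma(1/2), which is at most 1 because
   Gamma(1/2)^2 >= 2. *)
have -> : 4 * expR (- (pi * tau)) * (2 `^ (- 2^-1) * x `^ (- 2^-1)) * B =
    Gamma (2^-1 / 2) ^+ 2 * (x `^ (- 2^-1) * expR (- (pi * tau))) *
    (2 * (2 `^ (- 2^-1) / Gamma (2^-1 : R))).
  by rewrite /B; field; rewrite gt_eqF.
rewrite -[leRHS]mulr1; apply: ler_wpM2l.
  apply: mulr_ge0; first exact: sqr_ge0.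
  by apply: mulr_ge0; [exact: powR_ge0|exact: expR_ge0].
rewrite powRNhalf// -invfM ler_pdivrMr; last by rewrite mulr_gt0 ?sqrtr_gt0.
rewrite mul1r -[leLHS]sqr_sqrtr// expr2 ler_pM2l ?sqrtr_gt0//.
rewrite -[leRHS]ger0_norm ?(ltW G0)// -sqrtr_sqr ler_wsqrtr//.
exact: sqr_Gamma_half_ge2.
Unshelve. all: end_near. Qed.

End exponential_decay.

(* The theorem is the case p = 2^-n, m = 2^n pi / 2. *)
Definition macdonald_bound {R : realType} (p m : R) := forall tau x : R,
  0 < tau -> 0 < x -> `|macdonald_im tau x| <=
    Gamma (p / 2) / 2 `^ (1 - p) * (Num.sqrt x * sinh (m * tau)) `^ (- p).

Section macdonald_bound.
Context {R : realType}.

Let powR_half_sqr (a q : R) : (a `^ (q / 2)) ^+ 2 = a `^ q.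
Proof. by rewrite -powR_mulrn ?powR_ge0// -powRrM divfK. Qed.

Let abs_le_sqr (y z : R) : 0 <= z -> y ^+ 2 <= z ^+ 2 -> `|y| <= z.
Proof.
by move=> z0 yz; rewrite -(@ler_pXn2r _ 2%N)// real_normK// num_real.
Qed.

(** After squaring, all that remains is e^(-pi tau) <= 1 / (2 sinh (pi tau)). *)
Lemma macdonald_bound_half : macdonald_bound (2^-1) (pi : R).
Proof.
move=> tau x tau0 x0.
have S0 : 0 < sinh (pi * tau) by rewrite sinh_gt0// mulr_gt0// pi_gt0.
have x12 : 0 < Num.sqrt x by rewrite sqrtr_gt0.
have G0 : 0 < Gamma (2^-1 / 2 : R) by apply: Gamma_gt0; lra.
apply: abs_le_sqr.
  by rewrite mulr_ge0 ?powR_ge0// divr_ge0 ?powR_ge0// ltW.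
apply: (le_trans (sqr_macdonald_expR_le (ltW tau0) x0)).
have -> : 1 - 2^-1 = 1 / 2 :> R by field.
have -> : - 2^-1 = (- 1) / 2 :> R by field.
rewrite !exprMn !exprVn !powR_half_sqr powRr1// powR_inv1; last first.
  by rewrite mulr_ge0 ?ltW.
rewrite -mulrA ler_wpM2l ?sqr_ge0// mulN1r powRNhalf ?(ltW x0)// invfM mulrCA.
rewrite ler_pM2l ?invr_gt0// expRN -invfM.
have S2 : 0 < 2 * sinh (pi * tau) by rewrite pmulr_rgt0.
rewrite lef_pV2 ?posrE ?expR_gt0//.
by have := sinh_le_expR (pi * tau); lra.
Qed.

(** The hypothesis at 2 tau and 2 x cosh v depends on v only through (2 cosh v)^(-p/2). Integrating
    this power produces Gamma(p/4)^2 / (2 Gamma(p/2)), and Gamma(p/2) cancels against the constant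
    of the hypothesis. *)
Lemma macdonald_bound_step (p m : R) : 0 < p -> p <= 1 -> 0 < m ->
  macdonald_bound p m -> macdonald_bound (p / 2) (2 * m).
Proof.
move=> p0 p1 m0 IH tau x tau0 x0.
set S := sinh (2 * m * tau).
have S0 : 0 < S by rewrite sinh_gt0// !mulr_gt0.
have x12 : 0 < Num.sqrt x by rewrite sqrtr_gt0.
have G0 : 0 < Gamma (p / 2) by apply: Gamma_gt0; lra.
have G1 : 0 < Gamma (p / 2 / 2) by apply: Gamma_gt0; lra.
have A0 : 0 < 2 `^ (1 - p) :> R by exact: powR_gt0.
apply: abs_le_sqr.
  by apply: mulr_ge0; [rewrite divr_ge0 ?powR_ge0// ltW|exact: powR_ge0].
pose c := Gamma (p / 2) / 2 `^ (1 - p) * (Num.sqrt x * S) `^ (- p).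
have c_ge0 : 0 <= c.
  by apply: mulr_ge0; [rewrite divr_ge0 ?ltW|exact: powR_ge0].
pose h v := c * (2 * cosh v) `^ (- (p / 2)).
have mh : measurable_fun setT h by rewrite /h; measurability.
have hK v : `|macdonald_im (2 * tau) (2 * x * cosh v)| <= h v.
  have c0 : 0 < 2 * cosh v by rewrite mulr_gt0// cosh_gt0.
  have -> : 2 * x * cosh v = x * (2 * cosh v) by ring.
  apply: (le_trans (IH _ _ (mulr_gt0 _ tau0) (mulr_gt0 x0 c0))) => //.
  suff E : (Num.sqrt (x * (2 * cosh v)) * sinh (m * (2 * tau))) `^ (- p) =
      (Num.sqrt x * S) `^ (- p) * (2 * cosh v) `^ (- (p / 2)).
    by rewrite E /h /c mulrA.
  have -> : m * (2 * tau) = 2 * m * tau by ring.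
  rewrite -/S sqrtrM ?(ltW x0)// mulrAC.
  rewrite (powRM _ (mulr_ge0 (ltW x12) (ltW S0)) (sqrtr_ge0 _)); congr (_ * _).
  by rewrite -powR12_sqrt ?(ltW c0)// -powRrM; congr (_ `^ _); field.
have := sqr_macdonald_le x0 mh hK.
have -> : (\int[@lebesgue_measure R]_v (h v)%:E =
    (c * (Gamma (p / 2 / 2) ^+ 2 / (2 * Gamma (p / 2))))%:E)%E.
  rewrite EFinM -integral_cosh_powR; [|lra|lra].
  rewrite -ge0_integralZl//; first last.
  - by move=> v _; rewrite lee_fin powR_ge0.
  - by apply/measurable_EFinP; measurability.
rewrite lee_fin => le_sqr; apply: (le_trans le_sqr).
have E1 : ((Num.sqrt x * S) `^ (- (p / 2))) ^+ 2 = (Num.sqrt x * S) `^ (- p).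
  by rewrite -mulNr powR_half_sqr.
have E2 : (2 `^ (1 - p / 2)) ^+ 2 = 2 * 2 `^ (1 - p) :> R.
  have -> : 1 - p / 2 = (1 + (1 - p)) / 2 by field.
  by rewrite powR_half_sqr powRD ?powRr1// pnatr_eq0 implybT.
rewrite exprMn E1 expr_div_n E2 /c.
(* The constants agree exactly, so the induction step loses nothing beyond the product formula with
   absolute values. *)
rewrite le_eqVlt; apply/orP; left; apply/eqP.
move: ((_ * S) `^ _) => z; field.
by rewrite !gt_eqF.
Qed.

End macdonald_bound.

Theorem mainTheorem11 (R : realType) (n : nat) (x tau : R)
    (hn : (0 < n)%N) (hx : 0 < x) (htau : 0 < tau) :
  `|macdonald_im tau x| <=
    Gamma (2 ^- n.+1) / 2 `^ (1 - 2 ^- n) *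
    (Num.sqrt x * sinh (2 ^+ n * pi * tau / 2)) `^ (- 2 ^- n).
Proof.
have pi0 := pi_gt0 R.
have bound : macdonald_bound (2 ^- n) (2 ^+ n * pi / 2 : R).
  (* The induction starts at n = 1, where p = 1/2 and m = pi; each step halves p and doubles m. *)
  case: n hn => // n _; elim: n => [|n IHn].
    rewrite expr1 (_ : 2 * pi / 2 = pi); last by field.
    exact: macdonald_bound_half.
  have -> : 2 ^- n.+2 = 2 ^- n.+1 / 2 :> R by rewrite exprSr invfM.
  have -> : 2 ^+ n.+2 * pi / 2 = 2 * (2 ^+ n.+1 * pi / 2) :> R.
    by rewrite (exprS _ n.+1) !mulrA.
  apply: macdonald_bound_step => //.
  - by rewrite invf_le1 ?exprn_gt0// exprn_ege1// ler1n.
  - by rewrite !mulr_gt0.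
have := bound tau x htau hx.
by rewrite -[in X in Gamma X]invfM -exprSr (mulrAC _ _ tau).
Qed.
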